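(* Let $G$ be a locally compact abelian group with dual group $\hat G$. Then the following are equivalent for a probability measure $\mu \in M^1(G)$: (i) $\mu$ is adapted; (ii) if $\gamma \in \hat{G}$ is such that $\gamma|_{\operatorname{supp}\mu} \equiv 1$, then $\gamma = 1$; (iii) $\{ \gamma \in \hat{G} : \hat{\mu}(\gamma) = 1 \} = \{ 1 \}$.
   Context: $M^1(G)$ denotes the set of regular Borel probability measures on $G$. A measure $\mu\in M^1(G)$ is called adapted if the closed subgroup of $G$ generated by $\operatorname{supp}\mu$ is all of $G$. The Fourier--Stieltjes transform of $\mu$ is $\hat\mu(\gamma)=\int_G\overline{\gamma(x)}\,d\mu(x)$ for $\gamma\in\hat G$; the symbol $1$ in (ii) and (iii) also denotes the trivial character. *)

(* Defs.v *)
From HB Require Import structures.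
From mathcomp Require Import all_boot all_order all_algebra.
From mathcomp Require Import all_classical all_reals all_analysis.
From mathcomp Require Import complex.

Set Implicit Arguments.
Unset Strict Implicit.
Unset Printing Implicit Defensive.

Import Order.TTheory GRing.Theory Num.Theory.
Import numFieldNormedType.Exports.

Local Open Scope classical_set_scope.
Local Open Scope ring_scope.

(* A measurableType is pointed, a topologicalZmodType is not; the alias
   carries the base point 0, so that G itself needs no extra structure. *)
Definition pointed_group (G : topologicalZmodType) : Type := G.

HB.instance Definition _ (G : topologicalZmodType) :=
  Choice.on (pointed_group G).
HB.instance Definition _ (G : topologicalZmodType) :=
  isPointed.Build (pointed_group G) (0 : G).

Definition borel (G : topologicalZmodType) : measurableType _ :=
  g_sigma_algebraType (@open G : set (set (pointed_group G))).

Section adapted.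
Context (R : realType) (G : topologicalZmodType).
Implicit Type mu : probability (borel G) R.

Definition regular_measure mu : Prop :=
  forall A : set (borel G), measurable A ->
    mu A = ereal_inf [set mu U | U in [set U : set G | open U /\ A `<=` U]] /\
    mu A = ereal_sup [set mu K | K in [set K : set G | compact K /\ K `<=` A]].

Definition supp mu : set G :=
  [set x | forall U : set G, open U -> U x -> (0 < mu U)%E].

Definition closed_subgroup (H : set G) : Prop :=
  GRing.zmod_closed [in H] /\ closed H.

Definition closed_subgroup_generated (S : set G) : set G :=
  smallest closed_subgroup S.

Definition adapted mu : Prop := closed_subgroup_generated (supp mu) = setT.

(* R[i]^o carries the topology of the modulus. *)
Definition dual_group : set (G -> R[i]) :=
  [set g : G -> R[i] | [/\ {morph g : x y / x + y >-> x * y},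
                        forall x, `|g x| = 1
                      & continuous (g : G -> R[i]^o)]].

Definition trivial_character : G -> R[i] := cst 1.

Definition complex_integral mu (f : G -> R[i]) : R[i] :=
  Complex (\int[mu]_x complex.Re (f x)) (\int[mu]_x complex.Im (f x)).

Definition fourier_stieltjes mu (g : G -> R[i]) : R[i] :=
  complex_integral mu (fun x => (g x)^*).

End adapted.

Arguments trivial_character {R G}.
Arguments dual_group : clear implicits.

(* Main.v *)
(* All the implications are soft except the last: a proper closed subgroup [H]
   of [G] is in the kernel of a nontrivial continuous character. This is proved
   without Haar measure or spectral theory, for any group with a filter of
   neighbourhoods making it locally precompact (here, [G] modulo [H]).

   An averaging argument and Hahn-Banach give a translation invariant positive
   functional [J] on bounded functions with totally bounded support, hence a
   translation invariant norm [energy u = J |u|^2]. For a bump function [f] the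
   operator [S u = f * (u (. + a) - u)] commutes with the translations, and so
   does the form [L energy u - energy (S u) >= 0], with [L > 0] the square of the
   norm of [S]. If [u] nearly maximizes [energy (S u) / energy u] and [T] is a
   translation, [nu ^ 2 = mu] and [T^2 u] is close to [mu u], then by the
   parallelogram law one of [u + nu^-1 T u], [u - nu^-1 T u] is still nearly
   maximizing, and is closer to being an eigenvector of [T]. Iterating gives
   nearly maximizing approximate eigenvectors of any finite set of translations,
   and a limit of the eigenvalues is a character [chi]; it is continuous and
   satisfies [chi a <> 1] because [S] smooths and kills vectors fixed by the
   translation by [a]. *)
Require Import Defs.
From HB Require Import structures.
From mathcomp Require Import all_boot all_order all_algebra.
From mathcomp Require Import all_classical all_reals all_analysis.
From mathcomp Require Import measurable_realfun complex.
From mathcomp Require Import ring lra.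

Set Implicit Arguments.
Unset Strict Implicit.
Unset Printing Implicit Defensive.

Import Order.TTheory GRing.Theory Num.Theory.
Import numFieldNormedType.Exports.

Local Open Scope classical_set_scope.
Local Open Scope ring_scope.

(** * Linear functionals dominated by a sublinear one *)

Section dominated_linear.
Context (R : realType) (V : lmodType R) (D : set V).
Hypotheses (DD : forall x y, D x -> D y -> D (x + y))
           (DZ : forall (t : R) x, D x -> D (t *: x)).
Implicit Types (p q : V -> R) (t : R).

Definition sublinear_on p := (forall x y, D x -> D y -> p (x + y) <= p x + p y) /\
  (forall t x, 0 < t -> D x -> p (t *: x) = t * p x).

Let DN x : D x -> D (- x).
Proof. by rewrite -scaleN1r; exact: DZ. Qed.

Lemma sublinear_on0 p x : sublinear_on p -> D x -> p 0 = 0.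
Proof.
move=> [_ pZ] Dx; have D0 : D 0 by rewrite -(scale0r x); exact: DZ.
by have := pZ 2 0 ltac:(lra) D0; rewrite scaler0; lra.
Qed.

Lemma sublinear_onN p x : sublinear_on p -> D x -> - p (- x) <= p x.
Proof.
move=> sp Dx; have := sp.1 x (- x) Dx (DN Dx).
by rewrite subrr (sublinear_on0 sp Dx); lra.
Qed.

(** The infimum over a family directed downwards is subadditive because two members can be replaced
    by a common smaller one. Applied to a chain, it gives the bound that Zorn's lemma asks for; [l]
    keeps the infimum finite. *)
Lemma sublinear_on_inf (A : set (V -> R)) (l : V -> R) :
  A !=set0 -> (forall q, A q -> sublinear_on q) ->
  (forall q x, A q -> D x -> l x <= q x) ->
  (forall q q', A q -> A q' ->
    exists2 r, A r & forall x, D x -> r x <= q x /\ r x <= q' x) ->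
  let m x := inf [set q x | q in A] in
  sublinear_on m /\ (forall q x, A q -> D x -> m x <= q x).
Proof.
move=> [q0 Aq0] Asub Al Adir m.
have mlb q x : A q -> D x -> m x <= q x.
  move=> Aq Dx; apply: ge_inf; last by exists q.
  by exists (l x) => _ [r Ar <-]; exact: Al.
have mglb x c : (forall q, A q -> c <= q x) -> c <= m x.
  by move=> cq; apply: lb_le_inf => [|_ [r Ar <-]]; [exists (q0 x), q0|exact: cq].
have mle t x : 0 < t -> D x -> m (t *: x) <= t * m x.
  move=> t0 Dx; rewrite -ler_pdivrMl//; apply: (mglb _ _) => q Aq.
  by rewrite ler_pdivrMl// -(Asub _ Aq).2//; apply: mlb => //; exact: DZ.
split; last by [].
split=> [x y Dx Dy|t x t0 Dx]; last first.
  apply/eqP; rewrite eq_le mle//=.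
  have := @mle t^-1 (t *: x); rewrite invr_gt0 scalerA mulVf ?gt_eqF// scale1r.
  by move=> /(_ t0 (DZ t Dx)); rewrite ler_pdivlMl.
rewrite -lerBlDr; apply: (mglb _ _) => q Aq; rewrite lerBlDr -lerBlDl.
apply: (mglb _ _) => q' Aq'; rewrite lerBlDl.
have [r Ar rq] := Adir _ _ Aq Aq'.
apply: (le_trans (mlb _ _ Ar (DD Dx Dy))).
apply: (le_trans ((Asub _ Ar).1 _ _ Dx Dy)).
by apply: lerD; [exact: (rq x Dx).1|exact: (rq y Dy).2].
Qed.

(* The sublinear functional [x |-> inf_{t >= 0} p (x + t f) - t p f] lies below
   [p] and takes the value [- p f] at [- f], so a minimal [p] is linear. *)
Lemma sublinear_on_shift p f : sublinear_on p -> D f ->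
  exists q, [/\ sublinear_on q, forall x, D x -> q x <= p x & q (- f) <= - p f].
Proof.
move=> sp Df; have [pD pZ] := sp; have p0 := sublinear_on0 sp Df.
have D0 : D 0 by rewrite -(scale0r f); exact: DZ.
pose qt t x := p (x + t *: f) - t * p f.
pose q x := inf [set qt t x | t in [set t | 0 <= t]].
have pZ0 t x : 0 <= t -> D x -> p (t *: x) = t * p x.
  rewrite le_eqVlt => /predU1P[<- _|]; last exact: pZ.
  by rewrite scale0r p0 mul0r.
have qlb t x : 0 <= t -> D x -> - p (- x) <= qt t x.
  move=> t0 Dx; have := pD (x + t *: f) (- x) (DD Dx (DZ t Df)) (DN Dx).
  by rewrite addrAC subrr add0r pZ0// /qt; lra.
have qle t x : 0 <= t -> D x -> q x <= qt t x.
  move=> t0 Dx; apply: ge_inf; last by exists t.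
  by exists (- p (- x)) => _ [s s0 <-]; exact: qlb.
have qglb x c : (forall t, 0 <= t -> c <= qt t x) -> c <= q x.
  move=> cq; apply: lb_le_inf => [|_ [t t0 <-]]; last exact: cq.
  by exists (qt 0 x), 0 => //=.
have mle t x : 0 < t -> D x -> q (t *: x) <= t * q x.
  move=> t0 Dx; rewrite -ler_pdivrMl//; apply: (qglb _ _) => s s0.
  rewrite ler_pdivrMl//; apply: (le_trans (qle (t * s) _ _ _)).
  - by rewrite mulr_ge0// ltW.
  - exact: DZ.
  by rewrite /qt -scalerA -scalerDr pZ// ?mulrBr ?mulrA//; exact/DD/DZ.
exists q; split.
- split=> [x y Dx Dy|t x t0 Dx].
    rewrite -lerBlDr; apply: (qglb _ _) => s s0; rewrite lerBlDr -lerBlDl.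
    apply: (qglb _ _) => t t0; rewrite lerBlDl.
    apply: (le_trans (qle (s + t) _ _ (DD Dx Dy))); first exact: addr_ge0.
    have := pD (x + s *: f) (y + t *: f) (DD Dx (DZ s Df)) (DD Dy (DZ t Df)).
    by rewrite /qt addrACA -scalerDl; lra.
  apply/eqP; rewrite eq_le mle//=.
  have := @mle t^-1 (t *: x); rewrite invr_gt0 scalerA mulVf ?gt_eqF// scale1r.
  by move=> /(_ t0 (DZ t Dx)); rewrite ler_pdivlMl.
- by move=> x Dx; apply: (le_trans (qle 0 _ _ Dx)) => //; rewrite /qt; rewrite scale0r addr0 mul0r subr0.
- by apply: (le_trans (qle 1 _ _ (DN Df))) => //; rewrite /qt scale1r addNr p0 mul1r sub0r.
Qed.

(** The shift at [f] forces [J (- f) <= - p f] for every [J] below [q0]. A minimal sublinear [J]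
    below [q0] cannot be lowered by a shift at any [x], so [J (- x) = - J x], and subadditivity at
    [x], [y] and at their opposites becomes additivity. *)
Theorem dominated_linear p f : sublinear_on p -> D f -> exists J : V -> R,
  [/\ forall x y, D x -> D y -> J (x + y) = J x + J y,
      forall t x, D x -> J (t *: x) = t * J x,
      forall x, D x -> J x <= p x & J f = p f].
Proof.
move=> sp Df.
have [q0 [sq0 q0p q0f]] := sublinear_on_shift sp Df.
pose T := {q | sublinear_on q /\ forall x, D x -> q x <= q0 x}.
pose mkT q sq qq0 : T := exist _ q (conj sq qq0).
(* The order is reversed, so that a maximal element is a minimal functional. *)
pose below (q q' : {classic T}) :=
  `[< forall x, D x -> projT1 q' x <= projT1 q x >].
have [||A Atot|[J [sJ Jq0]] Jmin] :=
  @ZL_preorder {classic T} (mkT q0 sq0 (fun=> fun=> lexx _)) below.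
- by move=> q; apply/asboolP => x _.
- move=> q r s /asboolP rq /asboolP qs; apply/asboolP => x Dx.
  exact: le_trans (qs x Dx) (rq x Dx).
- have [[q1 Aq1]|A0] := pselect (A !=set0); last first.
    exists (mkT q0 sq0 (fun=> fun=> lexx _)) => q Aq.
    by case: A0; exists q.
  (* A sublinear functional below [q0] stays above [- q0 (- x)], which bounds the chain from
     below. *)
  have [||q x [r Ar <-] Dx|q r|sm mA] :=
    @sublinear_on_inf [set projT1 q | q in A] (fun x => - q0 (- x)).
  + by exists (projT1 q1), q1.
  + by move=> _ [[q [sq ?]] Aq <-].
  + have [sr rq0] := projT2 r.
    by apply: le_trans (sublinear_onN sr Dx); rewrite lerN2 rq0//; exact: DN.
  + move=> [q' Aq' <-] [r' Ar' <-].
    have [/asboolP qr|/asboolP rq] := Atot _ _ Aq' Ar'.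
      by exists (projT1 r'); [exists r'|move=> x Dx; split=> //; exact: qr].
    by exists (projT1 q'); [exists q'|move=> x Dx; split=> //; exact: rq].
  + have mq0 x : D x -> inf [set q x | q in [set projT1 q | q in A]] <= q0 x.
      move=> Dx; apply: (le_trans (mA (projT1 q1) x _ Dx)); first by exists q1.
      exact: (projT2 q1).2.
    exists (mkT _ sm mq0) => q Aq; apply/asboolP => x Dx /=.
    by apply: mA => //; exists q.
have {}Jmin q : sublinear_on q -> (forall x, D x -> q x <= J x) ->
    forall x, D x -> J x <= q x.
  move=> sq qJ; have qq0 x : D x -> q x <= q0 x.
    by move=> Dx; exact: le_trans (qJ x Dx) (Jq0 x Dx).
  by have /asboolP := Jmin (mkT q sq qq0) ltac:(exact/asboolP).
have JN x : D x -> J (- x) = - J x.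
  move=> Dx; have [q [sq qJ qx]] := sublinear_on_shift sJ Dx.
  apply/eqP; rewrite eq_le (le_trans (Jmin q sq qJ _ (DN Dx)) qx)/=.
  by have := sublinear_onN sJ Dx; rewrite lerNl.
have JD x y : D x -> D y -> J (x + y) = J x + J y.
  move=> Dx Dy; apply/eqP; rewrite eq_le sJ.1//=.
  have := sJ.1 _ _ (DN Dx) (DN Dy).
  by rewrite -opprD !JN//; [lra|exact: DD].
have Jp x : D x -> J x <= p x by move=> Dx; exact: le_trans (Jq0 _ Dx) (q0p _ Dx).
exists J; split=> //.
- move=> t x Dx; have [t0|t0|->] := ltgtP t 0; last 2 first.
  + exact: sJ.2.
  + by rewrite scale0r mul0r (sublinear_on0 sJ Dx).
  + by rewrite -(opprK (t *: x)) -scaleNr JN ?sJ.2// ?mulNr ?opprK//;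
      [lra|exact: DZ].
- apply/eqP; rewrite eq_le Jp//=.
  by have := le_trans (Jq0 _ (DN Df)) q0f; rewrite JN// lerN2.
Qed.

End dominated_linear.

(** * An invariant positive functional *)

Definition totally_bounded (G : zmodType) (F : set_system G) (B : set G) :=
  forall N, F N -> exists s : seq G, forall x, B x -> exists2 y, y \in s & N (x - y).

(** [F] stands for the neighbourhoods of 0 in a group topology that may fail to be Hausdorff: it
    will be that of a quotient [G / H], pulled back to [G]. The field [lpK] expresses local
    compactness. *)
Record locally_precompact (G : zmodType) (F : set_system G) : Prop := {
  lp_filter : Filter F;
  lp0 : forall N, F N -> N 0;
  lpB : forall N, F N -> exists2 N', F N' & forall x y, N' x -> N' y -> N (x - y);
  lpK : exists2 K, F K & totally_bounded F K }.

Section totally_bounded_theory.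
Context (G : zmodType) (F : set_system G) (lpF : locally_precompact F).
Local Notation tb := (totally_bounded F).

Lemma lpD N : F N -> exists2 N', F N' & forall x y, N' x -> N' y -> N (x + y).
Proof.
move=> FN; have [N1 FN1 N1B] := lpB lpF FN; have [N2 FN2 N2B] := lpB lpF FN1.
exists N2 => // x y Nx Ny; rewrite -[y]opprK; apply: N1B.
  by rewrite -[x]subr0; apply: N2B => //; exact: (lp0 lpF).
by rewrite -[- y]sub0r; apply: N2B => //; exact: (lp0 lpF).
Qed.

Lemma tb_sub A B : A `<=` B -> tb B -> tb A.
Proof. by move=> AB tB N /tB[s sB]; exists s => x /AB/sB. Qed.

Lemma tbU A B : tb A -> tb B -> tb (A `|` B).
Proof.
move=> tA tB N FN; have [s sA] := tA _ FN; have [t tB'] := tB _ FN.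
exists (s ++ t) => x [/sA|/tB'][y yst Ny]; exists y => //; rewrite mem_cat yst//.
by rewrite orbT.
Qed.

Lemma tb1 x : tb [set x].
Proof.
move=> N FN; exists [:: x] => _ ->; exists x; rewrite ?mem_head// subrr.
exact: (lp0 lpF).
Qed.

Lemma tbD A B : tb A -> tb B -> tb [set x + y | x in A & y in B].
Proof.
move=> tA tB N FN; have [N' FN' N'D] := lpD FN.
have [s sA] := tA _ FN'; have [t tB'] := tB _ FN'.
exists [seq x + y | x <- s, y <- t] => _ [a /sA[x xs Nx] [b /tB'[y yt Ny] <-]].
exists (x + y); first exact: allpairs_f.
by rewrite opprD addrACA; exact: N'D.
Qed.

Lemma tbN A : tb A -> tb [set - x | x in A].
Proof.
move=> tA N FN; have [N' FN' N'B] := lpB lpF FN.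
have [s sA] := tA _ FN'; exists (map -%R s) => _ [a /sA[x xs Nx] <-].
exists (- x); first exact: map_f.
by rewrite -opprD -[- (a - x)]sub0r; apply: N'B => //; exact: (lp0 lpF).
Qed.

End totally_bounded_theory.

(** * Bounded functions with totally bounded support *)

Section bounded_support.
Context (R : realType) (G : zmodType) (F : set_system G).
Hypothesis lpF : locally_precompact F.
Local Notation tb := (totally_bounded F).
Implicit Types (f g h : G -> R).

Definition bounded_fun_on h := exists M : R, forall x, `|h x| <= M.

Definition bsupp f := bounded_fun_on f /\ tb [set x | f x != 0].

Lemma bounded_ge0 h : bounded_fun_on h -> exists2 M, 0 <= M & forall x, `|h x| <= M.
Proof. by move=> [M hM]; exists M => //; apply: le_trans (hM 0). Qed.

Lemma bsupp_le f g : bsupp g -> (forall x, `|f x| <= `|g x|) -> bsupp f.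
Proof.
move=> [[M gM] tg] fg; split.
  by exists M => x; exact: le_trans (fg x) (gM x).
apply: tb_sub tg => x /=; apply: contraNN => /eqP g0.
by rewrite -normr_le0 (le_trans (fg x))// g0 normr0.
Qed.

Lemma bsuppD f g : bsupp f -> bsupp g -> bsupp (fun x => f x + g x).
Proof.
move=> [[M fM] tf] [[M' gM] tg]; split.
  by exists (M + M') => x; exact: le_trans (ler_normD _ _) (lerD (fM x) (gM x)).
apply: tb_sub (tbU tf tg) => x /=; have [->|] := eqVneq (f x) 0; last by left.
by rewrite add0r; right.
Qed.

Lemma bsuppMl h f : bounded_fun_on h -> bsupp f -> bsupp (fun x => h x * f x).
Proof.
move=> /bounded_ge0[M M0 hM] [[M' fM] tf]; split.
  by exists (M * M') => x; rewrite normrM ler_pM.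
by apply: tb_sub tf => x /=; apply: contraNN => /eqP->; rewrite mulr0.
Qed.

Lemma bsuppZ (t : R) f : bsupp f -> bsupp (fun x => t * f x).
Proof. by apply: bsuppMl; exists `|t|. Qed.

Lemma bsupp_norm f : bsupp f -> bsupp (fun x => `|f x|).
Proof. by move=> bf; apply: bsupp_le bf _ => x; rewrite normr_id. Qed.

Lemma bsupp_shift f y : bsupp f -> bsupp (fun x => f (x + y)).
Proof.
move=> [[M fM] tf]; split; first by exists M.
apply: tb_sub (tbD lpF tf (tb1 lpF (- y))) => x /= fx.
by exists (x + y) => //; exists (- y) => //; rewrite addrK.
Qed.

Lemma bsupp_ind (A : set G) : tb A -> bsupp (fun x => (x \in A)%:R).
Proof.
move=> tA; split; first by exists 1 => x; case: (x \in A); rewrite ?normr1 ?normr0.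
apply: tb_sub tA => x /=; have [|_] := boolP (x \in A); first by rewrite inE.
by rewrite eqxx.
Qed.

Lemma bsupp0 : bsupp (fun=> 0).
Proof.
split; first by exists 0 => x; rewrite normr0.
by move=> N FN; exists [::] => x /=; rewrite eqxx.
Qed.

End bounded_support.

(** * Covering averages of translates by a small neighbourhood *)

Section haar.
Context (R : realType) (G : zmodType) (F : set_system G).
Hypothesis lpF : locally_precompact F.
Local Notation tb := (totally_bounded F).
Local Notation bsupp := (@bsupp R G F).
Implicit Types (f g h : G -> R) (ys : seq G) (zs : seq (R * G)).

Definition step_fun (N : set G) zs x : R := \sum_(z <- zs) z.1 * (x - z.2 \in N)%:R.

(** The average of the translates of [f] by [ys] is dominated by translates of [N] of total weight
    [c], as in Haar's covering numbers; the factor [size ys] replaces a division. *)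
Definition step_cover N ys f c := exists zs, [/\ all (fun z => 0 <= z.1) zs,
  c = \sum_(z <- zs) z.1 &
  forall x, \sum_(y <- ys) f (x + y) <= (size ys)%:R * step_fun N zs x].

Lemma step_cover_ge0 N ys f c : step_cover N ys f c -> 0 <= c.
Proof.
move=> [zs [/allP zs0 -> _]]; rewrite big_seq; apply: sumr_ge0 => z; exact: zs0.
Qed.

Lemma step_coverD N ys f g c d :
  step_cover N ys f c -> step_cover N ys g d -> step_cover N ys (fun x => f x + g x) (c + d).
Proof.
move=> [zs [zs0 -> zsf]] [zs' [zs'0 -> zsg]]; exists (zs ++ zs').
split; rewrite ?all_cat ?zs0 ?big_cat// => x.
by rewrite /step_fun big_cat/= big_split/= mulrDr lerD.
Qed.

Lemma step_coverZ N ys f c t :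
  0 <= t -> step_cover N ys f c -> step_cover N ys (fun x => t * f x) (t * c).
Proof.
move=> t0 [zs [/allP zs0 -> zsf]]; exists [seq (t * z.1, z.2) | z <- zs]; split.
- by apply/allP => _ /mapP[z /zs0 z0 ->] /=; rewrite mulr_ge0.
- by rewrite big_map/= mulr_sumr.
- move=> x; rewrite -mulr_sumr (le_trans (ler_wpM2l t0 (zsf x)))//.
  rewrite mulrCA ler_wpM2l// /step_fun big_map mulr_sumr/=.
  by apply: ler_sum => z _; rewrite mulrA.
Qed.

(** Averaging over [ys'] spreads each translate of [N] over [size ys'] translates of the same total
    weight. This brings covers for two different lists to a common one. *)
Lemma step_cover_average N ys ys' f c : ys' != [::] -> step_cover N ys f c ->
  step_cover N [seq y + y' | y <- ys, y' <- ys'] f c.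
Proof.
move=> ys'0 [zs [/allP zs0 -> zsf]].
have n0 : (size ys')%:R != 0 :> R by rewrite pnatr_eq0 size_eq0.
exists [seq (z.1 / (size ys')%:R, z.2 - y') | z <- zs, y' <- ys']; split.
- by apply/allP => _ /allpairsP[[z y] /= [/zs0 z0 _ ->]] /=; rewrite divr_ge0.
- rewrite big_allpairs_dep/=; apply: eq_bigr => z _.
  by rewrite big_const_seq count_predT iter_addr_0 -[RHS]mulr_natr divfK.
- move=> x; rewrite big_allpairs_dep/= exchange_big/=.
  rewrite /step_fun big_allpairs_dep/= [in leRHS]exchange_big/= size_allpairs natrM -mulrA.
  rewrite 2!mulr_sumr; apply: ler_sum => y _.
  under eq_bigr do rewrite addrA addrAC.
  apply: (le_trans (zsf (x + y))); rewrite ler_wpM2l// /step_fun mulr_sumr.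
  apply: ler_sum => z _; rewrite mulrA mulrCA divff// mulr1.
  by rewrite opprB addrA addrAC.
Qed.

Lemma step_cover_averageC N ys ys' f c : step_cover N [seq y + y' | y <- ys, y' <- ys'] f c ->
  step_cover N [seq y' + y | y' <- ys', y <- ys] f c.
Proof.
move=> [zs [zs0 cE zsf]]; exists zs; split=> // x.
rewrite size_allpairs mulnC -(size_allpairs +%R) (le_trans _ (zsf x))//.
rewrite !big_allpairs_dep/= [leRHS]exchange_big/=.
by apply: ler_sum => y' _; apply: ler_sum => y _; rewrite [y' + y]addrC.
Qed.

Lemma step_cover_bsupp N f : F N -> bsupp f -> exists2 c, 0 <= c & step_cover N [:: 0] f c.
Proof.
move=> FN [/bounded_ge0[M M0 fM] tf]; have [s sf] := tf _ FN.
pose zs := [seq (M, z) | z <- s].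
have zs0 : all (fun z => 0 <= z.1) zs by apply/allP => _ /mapP[z _ ->].
have cov : step_cover N [:: 0] f (\sum_(z <- zs) z.1).
  exists zs; split=> // x; rewrite big_seq1 addr0 mul1r /step_fun big_map/=.
  have [->|fx] := eqVneq (f x) 0; first by apply: sumr_ge0 => z _; rewrite mulr_ge0.
  have [y ys Ny] := sf x fx.
  rewrite (big_rem y ys)/= mem_set// mulr1 (le_trans (ler_norm _))//.
  apply: (le_trans (fM x)); rewrite lerDl.
  by apply: sumr_ge0 => z _; rewrite mulr_ge0.
by exists (\sum_(z <- zs) z.1) => //; exact: step_cover_ge0 cov.
Qed.

(* [f - f (. + y)] has averages over [0, y, .., (n-1) y] of size [O(1/n)]. *)
Lemma step_cover_coboundary N f y (eps : R) : F N -> bsupp f -> 0 < eps ->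
  exists ys c, [/\ ys != [::], c <= eps & step_cover N ys (fun x => f x - f (x + y)) c].
Proof.
move=> FN bf e0.
have bg : bsupp (fun x => `|f x|) by exact: bsupp_norm.
have [c c0 [zs [/allP zs0 cE zsf]]] := step_cover_bsupp FN bg.
(* After telescoping, two boundary terms remain, each covered with weight [c / n]: these are the two
   halves of [zs'] below. *)
pose n := (Num.truncn (2 * c / eps)).+1.
have nlt : 2 * c / eps < n%:R by rewrite truncnS_gt// divr_ge0// ?mulr_ge0// ltW.
have n0 : 0 < n%:R :> R by rewrite ltr0n.
pose ys := [seq y *+ i | i <- iota 0 n].
pose zs' := [seq (z.1 / n%:R, z.2) | z <- zs] ++ [seq (z.1 / n%:R, z.2 - y *+ n) | z <- zs].
exists ys, (\sum_(z <- zs') z.1); split=> //.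
  rewrite big_cat/= !big_map/= -mulr_suml -cE.
  have : 2 * c / n%:R <= eps by rewrite ler_pdivrMr// [eps * _]mulrC -ler_pdivrMr// ltW.
  by rewrite -mulrA; lra.
exists zs'; split=> //.
  by rewrite all_cat; apply/andP; split; apply/allP => _ /mapP[z /zs0 z0 ->] /=;
    rewrite divr_ge0.
move=> x; rewrite size_map size_iota big_map.
have -> : \sum_(i <- iota 0 n) (f (x + y *+ i) - f (x + y *+ i + y)) =
    f x - f (x + y *+ n).
  rewrite -[iota 0 n]/(index_iota 0 n).
  under eq_bigr do rewrite -addrA -mulrSr.
  rewrite (telescope_sumr_eq (fun i => - f (x + y *+ i)))// ?mulr0n ?addr0 1?opprK 1?addrC//.
  by move=> i _; rewrite opprK [RHS]addrC.
rewrite /step_fun big_cat/= mulrDr !big_map/=.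
have E (u : G) : n%:R * \sum_(z <- zs) z.1 / n%:R * (x - (z.2 - u) \in N)%:R =
    step_fun N zs (x + u).
  rewrite mulr_sumr; apply: eq_bigr => z _.
  by rewrite mulrA mulrCA divff ?gt_eqF// mulr1 opprB addrA addrAC.
have E0 : n%:R * \sum_(z <- zs) z.1 / n%:R * (x - z.2 \in N)%:R = step_fun N zs x.
  by rewrite -[x in RHS]addr0 -E; under [in RHS]eq_bigr do rewrite subr0.
rewrite E0 E; have := zsf x; have := zsf (x + y *+ n); rewrite !big_seq1 !addr0 !mul1r.
by have := ler_norm (f x); have := ler_norm (- f (x + y *+ n)); rewrite normrN; lra.
Qed.

(* Any list contains a separated sublist that is still dense up to [K]; no
   translate of a small [N] contains two points of a separated list. *)
Lemma step_cover_lower_bound (N K : set G) ys c : (forall x y, N x -> N y -> K (x - y)) ->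
  K 0 -> ys != [::] -> step_cover N ys (fun x => (x \in K)%:R) c -> 1 <= c.
Proof.
move=> NK K0 ysn0 [zs [/allP zs0 -> zsf]].
have [S [sepS denS]] : exists S, pairwise (fun s s' => s - s' \notin K) S /\
    forall y, y \in ys -> exists2 s, s \in S & K (y - s).
  elim: ys {ysn0 zsf} => [|y ys [S [sepS denS]]]; first by exists [::].
  have [[s sS Kys]|nS] := pselect (exists2 s, s \in S & K (y - s)).
    exists S; split=> // u; rewrite inE => /predU1P[->|/denS//]; by exists s.
  exists (y :: S); split=> [/=|u]; last first.
    rewrite inE => /predU1P[->|/denS[s sS Kus]].
      by exists y; rewrite ?mem_head ?subrr.
    by exists s => //; rewrite inE sS orbT.
  rewrite sepS andbT; apply/allP => s sS /=; apply/negP => /set_mem Kys.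
  by apply: nS; exists s.
have n0 : 0 < (size ys)%:R :> R by rewrite ltr0n lt0n size_eq0.
have : (size ys)%:R <= (size ys)%:R * \sum_(z <- zs) z.1.
  (* Each [y] in [ys] lies in [s + K] for some [s] in [S], so the double sum counts it at least
     once; the cover is then evaluated at the points [- s]. *)
  apply: (@le_trans _ _ (\sum_(s <- S) \sum_(y <- ys) (- s + y \in K)%:R)).
    rewrite exchange_big/= -sum1_size natr_sum big_seq [leRHS]big_seq.
    apply: ler_sum => y /denS[s sS Kys].
    rewrite (big_rem s sS)/= [- s + y]addrC mem_set// lerDl.
    by apply: sumr_ge0 => i _.
  apply: (le_trans (ler_sum _ (fun s _ => zsf (- s)))).
  rewrite -mulr_sumr ler_wpM2l// /step_fun exchange_big/= big_seq [leRHS]big_seq.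
  apply: ler_sum => z /zs0 z0; rewrite -mulr_sumr ler_piMr//.
  (* At most one of the points [- s] lies in [z.2 + N], by separation, so each weight is counted at
     most once. *)
  elim: S sepS {denS} => [|s S IH] /=; first by rewrite big_nil.
  move=> /andP[/allP sS /IH le1]; rewrite big_cons.
  have [sN|_] := boolP (- s - z.2 \in N); last by rewrite add0r.
  rewrite big_seq big1 ?addr0// => s' s'S; have [s'N|//] := boolP (- s' - z.2 \in N).
  have := sS s' s'S; rewrite notin_setE; case.
  rewrite !inE in sN s'N; have := NK _ _ s'N sN.
  by rewrite opprD !opprK addrACA addNr addr0 addrC.
by rewrite ler_pMr.
Qed.

(** A substitute for the Haar integral, defined on the whole class [bsupp]; [ip_neq0] excludes the
    zero functional. *)
Record invariant_positive (J : (G -> R) -> R) : Prop := {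
  ipD : forall f g, bsupp f -> bsupp g -> J (fun x => f x + g x) = J f + J g;
  ipZ : forall t f, bsupp f -> J (fun x => t * f x) = t * J f;
  ip_ge0 : forall f, bsupp f -> (forall x, 0 <= f x) -> 0 <= J f;
  ip_shift : forall f y, bsupp f -> J (fun x => f (x + y)) = J f;
  ip_neq0 : exists2 K, tb K & 0 < J (fun x => (x \in K)%:R) }.

(** [p f] is the least weight of a cover of some average of [f]. It is sublinear since two averages
    have a common refinement, at most 0 on coboundaries and on nonpositive functions, and at least 1
    on the indicator of [K]. A linear [J] below [p] that agrees with [p] on this indicator has all
    the properties. *)
Theorem invariant_positive_exists : exists J, invariant_positive J.
Proof.
have [K FK tK] := lpK lpF; have [N FN NK] := lpB lpF FK.
pose C f := [set c | exists2 ys, ys != [::] & step_cover N ys f c].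
(* The translates averaged over make [p] vanish on coboundaries. *)
pose p f := inf (C f).
have Clb f : has_lbound (C f) by exists 0 => c [ys _]; exact: step_cover_ge0.
have C0 f : bsupp f -> C f !=set0.
  by move=> /(step_cover_bsupp FN)[c c0 cf]; exists c, [:: 0].
have ple f c : C f c -> p f <= c by move=> Cc; exact: ge_inf.
have pge f c : bsupp f -> (forall d, C f d -> c <= d) -> c <= p f.
  by move=> bf cC; apply: lb_le_inf; [exact: C0|exact: cC].
have CD f g c d : C f c -> C g d -> C (fun x => f x + g x) (c + d).
  move=> [ys ys0 cf] [ys' ys'0 cg]; exists [seq y + y' | y <- ys, y' <- ys'].
    by rewrite -size_eq0 size_allpairs muln_eq0 !size_eq0 negb_or ys0.
  apply: step_coverD; first exact: step_cover_average.
  exact/step_cover_averageC/step_cover_average.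
have CZ f c t : 0 < t -> C f c -> C (fun x => t * f x) (t * c).
  by move=> t0 [ys ys0 cf]; exists ys => //; apply: step_coverZ => //; exact: ltW.
have bK : bsupp (fun x => (x \in K)%:R) by exact: bsupp_ind.
have sp : sublinear_on (bsupp : set (G -> R^o)) p.
  split=> [f g bf bg|t f t0 bf].
    rewrite -lerBlDr; apply: (pge _ _ bf) => c Cc; rewrite lerBlDr -lerBlDl.
    by apply: (pge _ _ bg) => d Cd; rewrite lerBlDl; exact/ple/CD.
  have pZ s g : 0 < s -> bsupp g -> p (fun x => s * g x) <= s * p g.
    move=> s0 bg; rewrite -ler_pdivrMl//; apply: (pge _ _ bg) => c Cc.
    by rewrite ler_pdivrMl//; exact/ple/CZ.
  apply/eqP; rewrite eq_le pZ//=.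
  have := pZ t^-1 (fun x => t * f x); rewrite invr_gt0 => /(_ t0 (bsuppZ t bf)).
  rewrite ler_pdivlMl//; under [in X in p X]eq_fun do rewrite mulKf ?gt_eqF//.
  exact.
have [J [JD JZ Jp JK]] := dominated_linear (V := G -> R^o) (@bsuppD _ _ _)
  (fun t f => @bsuppZ _ _ _ t f) sp bK.
have JN f : bsupp f -> J (fun x => - f x) = - J f.
  by move=> bf; rewrite -mulN1r -JZ//; congr J; apply/funext => x; rewrite /= scaleN1r.
have p_le0 f : bsupp f -> (forall eps, 0 < eps -> exists2 c, c <= eps & C f c) -> J f <= 0.
  move=> bf fe; apply/ler_addgt0Pl => eps /fe[c ce Cc]; rewrite addr0.
  by apply: le_trans ce; exact: le_trans (Jp _ bf) (ple _ _ Cc).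
have cob f y : bsupp f -> J (fun x => f x - f (x + y)) <= 0.
  move=> bf; apply: p_le0.
    by apply: bsuppD => //; under eq_fun do rewrite -mulN1r; exact/bsuppZ/bsupp_shift.
  move=> eps e0; have [ys [c [ys0 ce cc]]] := step_cover_coboundary y FN bf e0.
  by exists c => //; exists ys.
have bN f : bsupp f -> bsupp (fun x => - f x).
  by move=> bf; under eq_fun do rewrite -mulN1r; exact: bsuppZ.
have JB f y : bsupp f -> J (fun x => f x - f (x + y)) = J f - J (fun x => f (x + y)).
  move=> bf; have by_ : bsupp (fun x => f (x + y)) by exact: bsupp_shift.
  by rewrite -JN//; apply: JD => //; exact: bN.
exists J; split=> //.
- move=> f bf f0; rewrite -oppr_le0 -JN//; apply: p_le0; first exact: bN.
  (* The empty cover, of weight 0, dominates [- f]. *)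
  move=> eps e0; exists 0; first exact: ltW.
  exists [:: 0] => //; exists [::]; split=> //; rewrite ?big_nil// => x.
  by rewrite /step_fun big_nil mulr0 big_seq1 oppr_le0.
- move=> f y bf; apply/eqP; rewrite eq_le; apply/andP; split; last first.
    by have := cob f y bf; rewrite JB// subr_le0.
  have bs := bsupp_shift lpF y bf; have := cob _ (- y) bs.
  have e : (fun x => f (x - y + y)) = f by apply/funext => x; rewrite subrK.
  by rewrite JB// e subr_le0.
- exists K => //; apply: (@lt_le_trans _ _ 1) => //; rewrite JK.
  apply: (pge _ _ bK) => c [ys ys0]; apply: step_cover_lower_bound NK _ ys0.
  exact: (lp0 lpF).
Qed.

End haar.

(** * Convolution *)

Section invariant_positive_theory.
Context (R : realType) (G : zmodType) (F : set_system G).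
Hypothesis lpF : locally_precompact F.
Local Notation tb := (totally_bounded F).
Local Notation bsupp := (@bsupp R G F).
Context (J : (G -> R) -> R).
Hypothesis ipJ : invariant_positive F J.
Implicit Types (f g u w : G -> R).

Lemma bsuppN f : bsupp f -> bsupp (fun x => - f x).
Proof. by move=> bf; under eq_fun do rewrite -mulN1r; exact: bsuppZ. Qed.

Lemma bsuppB f g : bsupp f -> bsupp g -> bsupp (fun x => f x - g x).
Proof. by move=> bf bg; apply: bsuppD => //; exact: bsuppN. Qed.

Lemma bsuppMr h f : bounded_fun_on h -> bsupp f -> bsupp (fun x => f x * h x).
Proof. by move=> bh bf; under eq_fun do rewrite mulrC; exact: bsuppMl. Qed.

Lemma bsupp_sum (I : eqType) (s : seq I) (f : I -> G -> R) : (forall i, bsupp (f i)) ->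
  bsupp (fun x => \sum_(i <- s) f i x).
Proof.
move=> bf; elim: s => [|i s IH]; first by under eq_fun do rewrite big_nil; exact: bsupp0.
by under eq_fun do rewrite big_cons; exact: bsuppD.
Qed.

Lemma ipN f : bsupp f -> J (fun x => - f x) = - J f.
Proof. by move=> bf; under eq_fun do rewrite -mulN1r; rewrite (ipZ ipJ)// mulN1r. Qed.

Lemma ipB f g : bsupp f -> bsupp g -> J (fun x => f x - g x) = J f - J g.
Proof. by move=> bf bg; rewrite (ipD ipJ)// ?ipN//; exact: bsuppN. Qed.

Lemma ip0 : J (fun=> 0) = 0.
Proof.
rewrite -[RHS](mul0r (J (fun=> 0))) -(ipZ ipJ _ (bsupp0 R F)).
by congr J; apply/funext => x; rewrite mul0r.
Qed.

Lemma ip_le f g : bsupp f -> bsupp g -> (forall x, f x <= g x) -> J f <= J g.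
Proof.
move=> bf bg fg; rewrite -subr_ge0 -ipB//; apply: (ip_ge0 ipJ); first exact: bsuppB.
by move=> x; rewrite subr_ge0.
Qed.

Lemma ip_norm f : bsupp f -> `|J f| <= J (fun x => `|f x|).
Proof.
move=> bf; have bnf := bsupp_norm bf; rewrite ler_norml lerNl -ipN//.
apply/andP; split; last by apply: ip_le => // x; exact: ler_norm.
by apply: ip_le => // [|x]; [exact: bsuppN|rewrite -normrN ler_norm].
Qed.

Lemma ip_sum (I : eqType) (s : seq I) (f : I -> G -> R) : (forall i, bsupp (f i)) ->
  J (fun x => \sum_(i <- s) f i x) = \sum_(i <- s) J (f i).
Proof.
move=> bf; elim: s => [|i s IH].
  by rewrite big_nil; under eq_fun do rewrite big_nil; exact: ip0.
rewrite big_cons -IH -(ipD ipJ)//; last exact: bsupp_sum.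
by under eq_fun do rewrite big_cons.
Qed.

(** A set [K] with [J] positive on its indicator is covered by finitely many translates of [N], so
    this indicator is below a finite sum of translates of [c^-1 * f], and [J f = 0] would contradict
    its positivity. *)
Lemma ip_gt0 f N x0 (c : R) : bsupp f -> (forall x, 0 <= f x) -> F N -> 0 < c ->
  (forall v, N v -> c <= f (x0 + v)) -> 0 < J f.
Proof.
move=> bf f0 FN c0 Nf; have [K tK JK] := ip_neq0 ipJ; have [s sK] := tK _ FN.
have Jf0 := ip_ge0 ipJ bf f0.
have bs y : bsupp (fun x => c^-1 * f (x + (x0 - y))) by exact/bsuppZ/bsupp_shift.
have : J (fun x => (x \in K)%:R) <= \sum_(y <- s) c^-1 * J f.
  under eq_bigr => y _ do rewrite -(ip_shift ipJ (x0 - y) bf) -(ipZ ipJ _ (bsupp_shift lpF _ bf)).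
  rewrite -ip_sum//; apply: ip_le; [exact: bsupp_ind|exact: bsupp_sum|move=> x].
  have s0 y : 0 <= c^-1 * f (x + (x0 - y)) by rewrite mulr_ge0// invr_ge0 ltW.
  have [/set_mem/sK[y ys Ny]|_] := boolP (x \in K); last by apply: sumr_ge0.
  rewrite (big_rem y ys)/= (@le_trans _ _ (c^-1 * f (x + (x0 - y))))//; last first.
    by rewrite lerDl sumr_ge0.
  by rewrite ler_pdivlMl// mulr1 addrCA; exact: Nf.
rewrite lt_neqAle Jf0 andbT; apply: contraTN => /eqP <-.
by rewrite -ltNge big1// => y _; rewrite mulr0.
Qed.

(** With [|f|] as a weight, the integral of [(|u| - t) ^ 2] is a nonnegative polynomial in [t] of
    degree at most 2; its discriminant gives the inequality. *)
Lemma ip_cauchy_schwarz f u : bsupp f -> bounded_fun_on u ->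
  J (fun x => f x * u x) ^+ 2 <= J (fun x => `|f x|) * J (fun x => `|f x| * u x ^+ 2).
Proof.
move=> bf bu; have bnf := bsupp_norm bf.
have bnu : bounded_fun_on (fun x => `|u x|).
  by have [M uM] := bu; exists M => x; rewrite normr_id.
have bu2 : bounded_fun_on (fun x => u x ^+ 2).
  have [M M0 uM] := bounded_ge0 bu; exists (M ^+ 2) => x.
  by rewrite normrX lerXn2r// ?nnegrE.
pose a := J (fun x => `|f x|); pose c := J (fun x => `|f x| * u x ^+ 2).
rewrite -/a -/c.
pose b := J (fun x => `|f x| * `|u x|).
have bfu : bsupp (fun x => `|f x| * `|u x|) by exact: bsuppMr.
have bfu2 : bsupp (fun x => `|f x| * u x ^+ 2) by exact: bsuppMr.
have ab t : 0 <= c - 2 * t * b + t ^+ 2 * a.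
  rewrite /a /b /c -(ipZ ipJ (2 * t) bfu) -(ipZ ipJ (t ^+ 2) bnf) -ipB//; last exact: bsuppZ.
  rewrite -(ipD ipJ); [|by apply: bsuppB => //; exact: bsuppZ|exact: bsuppZ].
  apply: (ip_ge0 ipJ) => [|x]; first by apply: bsuppD; [apply: bsuppB|]=> //; exact: bsuppZ.
  rewrite -(real_normK (num_real (u x))).
  rewrite (_ : _ - _ + _ = `|f x| * (`|u x| - t) ^+ 2); last by ring.
  by rewrite mulr_ge0 ?sqr_ge0.
have le_b : `|J (fun x => f x * u x)| <= b.
  apply: le_trans (ip_norm _) _; first exact: bsuppMr.
  by rewrite /b; under eq_fun do rewrite normrM.
have b0 : 0 <= b by exact: le_trans le_b.
have a0 : 0 <= a by apply: (ip_ge0 ipJ).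
suff : b ^+ 2 <= a * c.
  apply: le_trans; rewrite -(real_normK (num_real (J _))).
  by rewrite lerXn2r// nnegrE.
have [a00|an0] := eqVneq a 0.
  have [->|bn0] := eqVneq b 0; first by rewrite a00 mul0r expr0n.
  have bp : 0 < b by rewrite lt0r bn0.
  (* The leading coefficient vanishes here, and this [t] would give the polynomial the value -1. *)
  have := ab ((c + 1) / (2 * b)); rewrite a00 mulr0 addr0.
  by rewrite (_ : 2 * _ * b = c + 1); [lra|field].
have ap : 0 < a by rewrite lt0r an0.
have := ab (b / a); rewrite (_ : _ + _ = (a * c - b ^+ 2) / a); last by field.
by rewrite pmulr_lge0 ?invr_gt0// subr_ge0.
Qed.

Definition ucont f := forall eps : R, 0 < eps ->
  exists2 N, F N & forall x v, N v -> `|f (x + v) - f x| <= eps.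

(** The counterpart of the continuous functions with compact support. *)
Definition ucsupp f := bsupp f /\ ucont f.

Lemma ucsupp_bsupp f : ucsupp f -> bsupp f. Proof. by case. Qed.

Lemma ucsupp_bounded f : ucsupp f -> bounded_fun_on f. Proof. by move=> [[]]. Qed.

Lemma ucsupp0 : ucsupp (fun=> 0).
Proof.
split; first exact: bsupp0.
move=> e e0; exists setT; first exact: (@filterT _ _ (lp_filter lpF)).
by move=> x u _; rewrite subrr normr0 ltW.
Qed.

Lemma ucsuppD f g : ucsupp f -> ucsupp g -> ucsupp (fun x => f x + g x).
Proof.
move=> [bf uf] [bg ug]; split; first exact: bsuppD.
move=> e e0; have e2 : 0 < e / 2 by rewrite divr_gt0.
have [N FN fN] := uf _ e2; have [N' FN' gN'] := ug _ e2.
exists (N `&` N'); first exact: (@filterI _ _ (lp_filter lpF)).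
move=> x v [Nv N'v]; rewrite opprD addrACA (splitr e) (le_trans (ler_normD _ _))//.
by rewrite lerD ?fN ?gN'.
Qed.

Lemma ucsuppZ (t : R) f : ucsupp f -> ucsupp (fun x => t * f x).
Proof.
move=> [bf uf]; split; first exact: bsuppZ.
move=> e e0; have t1 : 0 < `|t| + 1 by rewrite ltr_wpDl.
have [N FN fN] := uf (e / (`|t| + 1)) ltac:(by rewrite divr_gt0).
exists N => // x v Nv; rewrite -mulrBr normrM.
have := fN x v Nv; rewrite ler_pdivlMr//; apply: le_trans.
by rewrite mulrC ler_wpM2l// lerDl.
Qed.

Lemma ucsuppB f g : ucsupp f -> ucsupp g -> ucsupp (fun x => f x - g x).
Proof.
by move=> gf gg; apply: ucsuppD => //; under eq_fun do rewrite -mulN1r; exact: ucsuppZ.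
Qed.

Lemma ucsupp_shift f y : ucsupp f -> ucsupp (fun x => f (x + y)).
Proof.
move=> [bf uf]; split; first exact: bsupp_shift.
by move=> e /uf[N FN fN]; exists N => // x v Nv; rewrite addrAC; exact: fN.
Qed.

Lemma ucsupp_sqr f : ucsupp f -> ucsupp (fun x => f x ^+ 2).
Proof.
move=> [bf uf]; have [M M0 fM] := bounded_ge0 bf.1; split.
  by under eq_fun do rewrite expr2; exact: bsuppMl bf.1 bf.
move=> e e0; have M1 : 0 < 2 * M + 1 by lra.
have [N FN fN] := uf (e / (2 * M + 1)) ltac:(by rewrite divr_gt0).
exists N => // x v Nv; rewrite subr_sqr normrM.
have := fN x v Nv; rewrite ler_pdivlMr//; apply: le_trans.
rewrite ler_wpM2l// (le_trans (ler_normD _ _))//.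
by have := fM x; have := fM (x + v); lra.
Qed.

Definition convol f u x := J (fun y => f y * u (x - y)).

Lemma bounded_reflect u x : bounded_fun_on u -> bounded_fun_on (fun y => u (x - y)).
Proof. by move=> [M uM]; exists M. Qed.

Lemma bsupp_convol_kernel f u x : bsupp f -> bounded_fun_on u -> bsupp (fun y => f y * u (x - y)).
Proof. by move=> bf bu; apply: bsuppMr => //; exact: bounded_reflect. Qed.

Lemma convol_bound f h (M : R) : bsupp f -> bounded_fun_on h -> (forall y, f y != 0 -> `|h y| <= M) ->
  `|J (fun y => f y * h y)| <= M * J (fun y => `|f y|).
Proof.
move=> bf bh hM; apply: (le_trans (ip_norm _)); first exact: bsuppMr.
rewrite -(ipZ ipJ _ (bsupp_norm bf)); apply: ip_le => [||x].
- exact/bsupp_norm/bsuppMr.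
- exact/bsuppZ/bsupp_norm.
- have [->|fx] := eqVneq (f x) 0; first by rewrite mul0r normr0 mulr0.
  by rewrite normrM mulrC ler_wpM2r ?hM.
Qed.

Lemma convolDr f u w x : bsupp f -> bounded_fun_on u -> bounded_fun_on w ->
  convol f (fun y => u y + w y) x = convol f u x + convol f w x.
Proof.
move=> bf bu bw; rewrite /convol -(ipD ipJ); try exact: bsupp_convol_kernel.
by under eq_fun do rewrite mulrDr.
Qed.

Lemma convolDl f g u x : bsupp f -> bsupp g -> bounded_fun_on u ->
  convol (fun y => f y + g y) u x = convol f u x + convol g u x.
Proof.
move=> bf bg bu; rewrite /convol -(ipD ipJ); try exact: bsupp_convol_kernel.
by under eq_fun do rewrite mulrDl.
Qed.

Lemma convolZr f u x (t : R) : bsupp f -> bounded_fun_on u ->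
  convol f (fun y => t * u y) x = t * convol f u x.
Proof.
move=> bf bu; rewrite /convol -(ipZ ipJ); last exact: bsupp_convol_kernel.
by under eq_fun do rewrite mulrCA.
Qed.

Lemma convolNl f u x : bsupp f -> bounded_fun_on u ->
  convol (fun y => - f y) u x = - convol f u x.
Proof.
move=> bf bu; rewrite /convol -ipN; last exact: bsupp_convol_kernel.
by under eq_fun do rewrite mulNr.
Qed.

Lemma convol_shiftr f u x y : convol f (fun z => u (z + y)) x = convol f u (x + y).
Proof. by rewrite /convol; under eq_fun do rewrite addrAC. Qed.

Lemma convol_shiftl f u x y : bsupp f -> bounded_fun_on u ->
  convol (fun z => f (z + y)) u x = convol f u (x + y).
Proof.
move=> bf bu; rewrite /convol -(ip_shift ipJ y (bsupp_convol_kernel (x + y) bf bu)).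
by congr J; apply/funext => z; rewrite opprD addrACA subrr addr0.
Qed.

Lemma convol_neq0 f u x : convol f u x != 0 ->
  [set y + z | y in [set y | f y != 0] & z in [set z | u z != 0]] x.
Proof.
apply: contraNP => nx; rewrite /convol (_ : (fun _ => _) = fun=> 0) ?ip0//.
apply/funext => y; apply/eqP; rewrite mulf_eq0 -implyNb; apply/implyP => fy.
apply/negP => /negP ux; apply: nx; exists y => //; exists (x - y) => //.
by rewrite addrC subrK.
Qed.

Lemma ucsupp_convol f u : bsupp f -> ucsupp u -> ucsupp (convol f u).
Proof.
move=> bf [bu uu]; have [M uM] := bu.1; split; first split.
- by exists (M * J (fun y => `|f y|)) => x; apply: convol_bound => //; exact: bounded_reflect bu.1.
- apply: tb_sub (tbD lpF bf.2 bu.2) => x; exact: convol_neq0.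
have Jf0 : 0 <= J (fun y => `|f y|) by apply: (ip_ge0 ipJ) => //; exact: bsupp_norm.
move=> e e0; have Jf1 : 0 < J (fun y => `|f y|) + 1 by rewrite ltr_wpDl.
have [N FN uN] := uu (e / (J (fun y => `|f y|) + 1)) ltac:(by rewrite divr_gt0).
exists N => // x v Nv.
have bx z : bsupp (fun y => f y * u (z - y)) by exact: bsupp_convol_kernel bu.1.
rewrite /convol -ipB//; under eq_fun do rewrite -mulrBr.
apply: le_trans (convol_bound (M := e / (J (fun y => `|f y|) + 1)) bf _ _) _.
- exists (M + M) => y; rewrite (le_trans (ler_normB _ _))//; exact: lerD.
- by move=> y _; rewrite addrAC; exact: uN.
by rewrite mulrAC ler_pdivrMr// ler_wpM2l ?(ltW e0)// lerDl.
Qed.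

(** When [f] lives on [y + N], where translation changes [w] by at most [e], the convolution is
    uniformly close to [J f] times the translate of [w] by [y]; the difference vanishes outside the
    set whose indicator appears in the bound. *)
Lemma convol_local (f w : G -> R) (A N : set G) (y : G) (e : R) :
  bsupp f -> ucsupp w -> tb A -> [set x | f x != 0] `<=` A -> A y -> 0 <= e ->
  (forall x v, N v -> `|w (x + v) - w x| <= e) -> (forall x, f x != 0 -> N (x - y)) ->
  `|J (convol f w) - J f * J w| <= e * J (fun x => `|f x|) *
    J (fun x => (x \in [set y + z | y in A & z in [set z | w z != 0]])%:R).
Proof.
move=> bf gw tA fA Ay e0 wN fN; have bbw := ucsupp_bounded gw; have bw := ucsupp_bsupp gw.
set B := [set y + z | y in A & z in _]; have bB := bsupp_ind R (tbD lpF tA bw.2).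
have Jf0 : 0 <= J (fun x => `|f x|) by apply: (ip_ge0 ipJ) => //; exact: bsupp_norm.
have bc := ucsupp_bsupp (ucsupp_convol bf gw); have bs := bsupp_shift lpF (- y) bw.
rewrite -(ip_shift ipJ (- y) bw) -(ipZ ipJ)// -ipB//; last exact: bsuppZ.
rewrite -(ipZ ipJ)//.
have bd := bsuppB bc (bsuppZ (J f) bs).
apply: (le_trans (ip_norm bd)); apply: ip_le; [exact: bsupp_norm|exact: bsuppZ|move=> x].
have BP : x \notin B -> convol f w x = 0 /\ w (x - y) = 0.
  rewrite notin_setE => nB; split.
    apply: contra_notP nB => /eqP/convol_neq0[t ft [z wz <-]].
    by exists t; [exact: fA|exists z].
  by apply: contra_notP nB => /eqP wxy; exists y => //; exists (x - y); rewrite // addrC subrK.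
have [_|/BP[-> ->]] := boolP (x \in B); last by rewrite mulr0 subrr normr0 mulr0.
rewrite mulr1 [J f * _]mulrC -(ipZ ipJ _ bf) -ipB; [|exact: bsupp_convol_kernel|exact: bsuppZ].
under eq_fun do rewrite [w (x - y) * _]mulrC -mulrBr.
apply: convol_bound => // [|t ft].
  have [M M0 wM] := bounded_ge0 bbw.
  by exists (M + M) => t; rewrite (le_trans (ler_normB _ _))//; exact: lerD.
rewrite -normrN opprB (_ : x - y = x - t + (t - y)); last by rewrite addrA subrK.
exact/wN/fN.
Qed.

(* [f] is cut into pieces supported on small translates of a neighbourhood. *)
Lemma ip_convol f w : bsupp f -> ucsupp w -> J (convol f w) = J f * J w.
Proof.
move=> bf gw; have bbw := ucsupp_bounded gw.
suff le_e (e : R) : 0 < e -> `|J (convol f w) - J f * J w| <= e.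
  apply/eqP; rewrite -subr_eq0 -normr_le0; apply/ler_addgt0Pl => e e0.
  by rewrite addr0; exact: le_e.
move=> e0; have [K0 FK0 tK0] := lpK lpF.
pose Kf := [set x | f x != 0].
(* [A] contains the support of [f] and every centre that is used, so one constant [MB] serves all
   the pieces. *)
pose A := [set t + k | t in Kf & k in [set - k | k in K0]].
have tA : tb A by apply: tbD => //; [exact: bf.2|exact: tbN].
pose B := [set y + z | y in A & z in [set z | w z != 0]].
pose MB := J (fun x => (x \in B)%:R).
have MB0 : 0 <= MB.
  by apply: (ip_ge0 ipJ) => //; apply: bsupp_ind; exact: tbD (ucsupp_bsupp gw).2.
have bnf := bsupp_norm bf; pose Jf := J (fun x => `|f x|).
have Jf0 : 0 <= Jf by exact: (ip_ge0 ipJ).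
have c0 : 0 < Jf * MB + 1 by rewrite ltr_wpDl// mulr_ge0.
pose d := e / (Jf * MB + 1); have d0 : 0 < d by rewrite divr_gt0.
have [N' FN' wN'] := gw.2 d d0.
pose N := N' `&` K0; have FN : F N by exact: (@filterI _ _ (lp_filter lpF)).
have wN x v : N v -> `|w (x + v) - w x| <= d by move=> [N'v _]; exact: wN'.
have KfA : Kf `<=` A.
  move=> t ft; exists t => //; exists 0; last by rewrite addr0.
  by exists 0; rewrite ?oppr0//; exact: (lp0 lpF).
(* Induction on the list of centres: the errors add up correctly because the norms [J |g|] and
   [J |h|] of the two disjoint pieces do. *)
suff claim (s : seq G) (f1 : G -> R) : bsupp f1 -> [set x | f1 x != 0] `<=` Kf ->
    (forall x, f1 x != 0 -> exists2 y, y \in s & N (x - y)) ->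
    `|J (convol f1 w) - J f1 * J w| <= d * J (fun x => `|f1 x|) * MB.
  have [s sf] := bf.2 N FN; apply: (le_trans (claim s f bf (@subset_refl _ _) sf)).
  by rewrite -/Jf -mulrA /d mulrAC ler_pdivrMr// ler_wpM2l ?(ltW e0)// lerDl.
elim: s f1 => [|y s IH] f1 b1 f1f f1s.
  have f10 : f1 = fun=> 0.
    by apply/funext => x; apply/eqP/negP => /negP/f1s[].
  have -> : convol f1 w = fun=> 0.
    by apply/funext => x; rewrite -ip0; congr J; apply/funext => z; rewrite f10 mul0r.
  have -> : (fun x => `|f1 x|) = fun=> 0 by apply/funext => x; rewrite f10 normr0.
  by rewrite f10 !ip0 mul0r mulr0 mul0r subrr normr0.
have [[t f1t Nty]|nt] := pselect (exists2 t, f1 t != 0 & N (t - y)); last first.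
  apply: IH => // x f1x; have [z] := f1s x f1x; rewrite inE => /predU1P[->|zs] Nz.
    by case: nt; exists x.
  by exists z.
have Ay : A y.
  exists t; first exact: f1f.
  by exists (y - t); [exists (t - y); [case: Nty|rewrite opprB]|rewrite addrC subrK].
pose g x := (`[< N (x - y) >])%:R * f1 x.
pose h x := (~~ `[< N (x - y) >])%:R * f1 x.
have bdd (P : G -> bool) : bounded_fun_on (fun x => (P x)%:R : R).
  by exists 1 => x; case: (P x); rewrite ?normr1 ?normr0.
have [bg bh] : bsupp g /\ bsupp h by split; exact: bsuppMl.
have fE : f1 = fun x => g x + h x.
  by apply/funext => x; rewrite /g /h; case: asbool; rewrite /= mul1r mul0r ?addr0 ?add0r.
have nfE : (fun x => `|f1 x|) = fun x => `|g x| + `|h x|.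
  apply/funext => x; rewrite /g /h; case: asbool;
    by rewrite /= mul1r mul0r normr0 ?addr0 ?add0r.
have -> : convol f1 w = fun x => convol g w x + convol h w x.
  by apply/funext => x; rewrite fE convolDl//; exact: ucsupp_bounded.
rewrite (ipD ipJ) ?nfE; try exact/ucsupp_bsupp/ucsupp_convol.
rewrite (ipD ipJ); try exact: bsupp_norm.
rewrite [in J f1]fE (ipD ipJ)// mulrDl opprD addrACA mulrDr mulrDl.
apply: le_trans (ler_normD _ _) _; apply: lerD.
  apply: (convol_local bg gw tA _ Ay (ltW d0) wN) => //.
    apply: subset_trans KfA; apply: subset_trans f1f => x /=.
    by apply: contraNN => /eqP f1x; rewrite /g f1x mulr0.
  by move=> x; rewrite /g; have [//|] := asboolP; rewrite mul0r eqxx.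
apply: IH => // [x /= hx|x].
  by apply: f1f => /=; apply: contraNN hx => /eqP f1x; rewrite /h f1x mulr0.
rewrite /h; have [_|nN] := asboolP; first by rewrite mul0r eqxx.
rewrite mul1r => /f1s[z]; rewrite inE => /predU1P[->//|zs] Nz; by exists z.
Qed.

(** Young's inequality: Cauchy-Schwarz with weight [|f|] at each point, then [ip_convol] in the
    place of Fubini's theorem. *)
Lemma ip_convol_sqr f u : bsupp f -> ucsupp u ->
  J (fun x => convol f u x ^+ 2) <= J (fun x => `|f x|) ^+ 2 * J (fun x => u x ^+ 2).
Proof.
move=> bf gu; have bnf := bsupp_norm bf; have gu2 := ucsupp_sqr gu.
rewrite expr2 -mulrA -ip_convol// -(ipZ ipJ); last exact/ucsupp_bsupp/ucsupp_convol.
apply: ip_le => [||x].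
- exact/ucsupp_bsupp/ucsupp_sqr/ucsupp_convol.
- exact/bsuppZ/ucsupp_bsupp/ucsupp_convol.
- by apply: ip_cauchy_schwarz => //; exact/bounded_reflect/ucsupp_bounded.
Qed.

End invariant_positive_theory.

(** * Uniformly continuous bump functions *)

Section bump.
Context (R : realType) (G : zmodType) (F : set_system G).
Hypothesis lpF : locally_precompact F.

Lemma halving_sequence N : F N -> exists U : nat -> set G,
  [/\ U 0%N = N, forall n, F (U n) &
      forall n x y, U n.+1 x -> U n.+1 y -> U n (x + y)].
Proof.
move=> FN; have /choice[h hP] : forall A : {A | F A}, exists B : {B | F B},
    forall x y, sval B x -> sval B y -> sval A (x + y).
  by move=> [A FA]; have [B FB BA] := lpD lpF FA; exists (exist _ B FB).
pose U n := iter n h (exist _ N FN).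
exists (fun n => sval (U n)); split=> // n; first exact: (svalP (U n)).
by move=> x y; exact: hP.
Qed.

(* The sets [A n k] play the role of balls of radius [k / 2 ^ n]. *)
Fixpoint dyadic_ball (U : nat -> set G) n k : set G :=
  if n is m.+1 then
    if odd k then [set x + y | x in dyadic_ball U m k./2 & y in U n]
    else dyadic_ball U m k./2
  else if k is 0 then [set 0] else if k is 1 then U 0%N else setT.

Section dyadic_ball_theory.
Context (U : nat -> set G).
Hypotheses (U0 : forall n, U n 0)
  (UD : forall n x y, U n.+1 x -> U n.+1 y -> U n (x + y)).
Local Notation A := (dyadic_ball U).

(** Binary addition with carry: for odd [k] the two summands from [U n] merge into one from the
    previous, larger set, and the induction goes on with [k./2]. *)
Lemma dyadic_ballD n k x y : A n k x -> U n y -> A n k.+1 (x + y).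
Proof.
elim: n k x y => [|n IH] k x y /=; first by case: k => [->|[]//]; rewrite add0r.
case: ifPn => kodd; last first.
  by rewrite uphalf_half (negbTE kodd) => Ax Uy; exists x => //; exists y.
move=> [x' Ax' [u Uu <-]] Uy; rewrite uphalf_half kodd -addrA.
by apply: IH => //; exact: UD.
Qed.

Lemma dyadic_ball_le n k l x : (k <= l)%N -> A n k x -> A n l x.
Proof.
move=> kl Ax; rewrite -(subnKC kl); elim: (l - k)%N => [|j IH]; first by rewrite addn0.
by rewrite addnS -(addr0 x); exact: dyadic_ballD.
Qed.

Lemma dyadic_ball_scale n k j : A (n + j) (k * 2 ^ j) = A n k.
Proof.
elim: j => [|j IH]; first by rewrite addn0 muln1.
by rewrite addnS expnS mulnCA mul2n /= odd_double doubleK.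
Qed.

(** The infimum of the radii of the balls that contain [x], as in the Birkhoff-Kakutani theorem. The
    radius 2 always occurs, since the ball for [n = 0], [k = 2] is everything. *)
Definition dyadic_norm x : R :=
  inf [set r | exists n k, A n k x /\ r = k%:R / 2 ^+ n].

Let dyadic_norm_le x n k : A n k x -> dyadic_norm x <= k%:R / 2 ^+ n.
Proof.
move=> Ax; apply: ge_inf; last by exists n, k.
by exists 0 => _ [m [l [_ ->]]]; rewrite divr_ge0// exprn_ge0.
Qed.

Lemma dyadic_norm0 : dyadic_norm 0 <= 0.
Proof. by have := @dyadic_norm_le 0 0 0 erefl; rewrite mul0r. Qed.

Lemma dyadic_norm_ge0 x : 0 <= dyadic_norm x.
Proof.
apply: lb_le_inf => [|_ [n [k [_ ->]]]]; last by rewrite divr_ge0// exprn_ge0.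
by exists (2 / 2 ^+ 0), 0%N, 2%N.
Qed.

Lemma dyadic_norm_lt1 x : dyadic_norm x < 1 -> U 0%N x.
Proof.
move=> /inf_lt[|_ [n [k [Ax ->]]]]; first by exists (2 / 2 ^+ 0), 0%N, 2%N.
rewrite ltr_pdivrMr ?exprn_gt0// mul1r -natrX ltr_nat => /ltnW kn.
by have := dyadic_ball_le kn Ax; rewrite -[(2 ^ n)%N]mul1n -{1}[n]add0n dyadic_ball_scale.
Qed.

(** One [1 / 2 ^+ n] pays for rounding a radius of a ball around [x] up to a multiple of
    [1 / 2 ^+ n], the other for adding [v]. *)
Lemma dyadic_norm_add n x v : U n v -> dyadic_norm (x + v) <= dyadic_norm x + 2 / 2 ^+ n.
Proof.
move=> Uv; rewrite -lerBlDr.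
apply: lb_le_inf => [|_ [m [k [Ax ->]]]]; first by exists (2 / 2 ^+ 0), 0%N, 2%N.
pose q := ((k * 2 ^ n) %/ 2 ^ m)%N.
have Aq : A n q.+1 x.
  rewrite -(dyadic_ball_scale n q.+1 m) addnC.
  apply: (@dyadic_ball_le _ (k * 2 ^ n)); last by rewrite dyadic_ball_scale.
  by rewrite ltnW// ltn_ceil// expn_gt0.
rewrite lerBlDr (le_trans (dyadic_norm_le (dyadic_ballD Aq Uv)))//.
have qk : q%:R * 2 ^+ m <= k%:R * 2 ^+ n :> R by rewrite -!natrX -!natrM ler_nat leq_divM.
rewrite -addn2 natrD mulrDl lerD2r ler_pdivrMr ?exprn_gt0// mulrAC.
by rewrite ler_pdivlMr ?exprn_gt0.
Qed.

End dyadic_ball_theory.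

(** The bump is the positive part of [1 - d]. It is uniformly continuous since adding [v] or [- v]
    raises [d] by at most [e] once both lie in [U n]. *)
Lemma bump_function N : F N -> exists f : G -> R,
  [/\ f 0 = 1, forall x, 0 <= f x, forall x, f x != 0 -> N x & ucont F f].
Proof.
move=> FN; have [U [U0N FU UD]] := halving_sequence FN.
have U0 n : U n 0 by exact: lp0 lpF _ (FU n).
pose d := dyadic_norm U; exists (fun x => Num.max 0 (1 - d x)); split.
- rewrite (_ : d 0 = 0) ?subr0; first by apply/max_idPr.
  by apply/eqP; rewrite eq_le dyadic_norm0 dyadic_norm_ge0.
- by move=> x; rewrite le_max lexx.
- move=> x dx; rewrite -U0N; apply: dyadic_norm_lt1 => //; rewrite ltNge.
  by apply: contraNN dx => d1; apply/eqP/max_idPl; rewrite subr_le0.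
move=> e e0; pose n := (Num.truncn (2 / e)).+1.
have en : 2 / 2 ^+ n <= e.
  rewrite ler_pdivrMr ?exprn_gt0// mulrC -ler_pdivrMr//.
  have /ltW/le_trans-> // : 2 / e < n%:R by rewrite truncnS_gt// divr_ge0// ltW.
  by rewrite -natrX ler_nat ltnW// ltn_expl.
have [V FV VU] := lpB lpF (FU n); have V0 := lp0 lpF FV.
exists V => // x v Vv.
have dD y w : U n w -> d (y + w) <= d y + e.
  by move=> Uw; rewrite (le_trans (dyadic_norm_add U0 UD y Uw))// lerD2l.
have Uv : U n v by rewrite -[v]subr0; exact: VU.
have UNv : U n (- v) by rewrite -[- v]sub0r; exact: VU.
have := dD x v Uv; have := dD (x + v) (- v) UNv; rewrite addrK ler_norml.
by rewrite /Num.max; case: ltP => ?; case: ltP => ? ? ?; lra.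
Qed.

End bump.

(** * Approximate eigenvectors *)

Section complex_normsq.
Context (R : rcfType).
Implicit Types (z w : R[i]).

(** The squared modulus, with values in [R], whereas the norm of [R[i]] takes its values in
    [R[i]]. *)
Definition normsq z : R := complex.Re z ^+ 2 + complex.Im z ^+ 2.

Lemma normsq_ge0 z : 0 <= normsq z.
Proof. by rewrite addr_ge0// sqr_ge0. Qed.

Lemma normsqM z w : normsq (z * w) = normsq z * normsq w.
Proof. by case: z w => [a b] [c d]; rewrite /normsq /=; ring. Qed.

Lemma normsq1 : normsq 1 = 1.
Proof. by rewrite /normsq /= expr1n expr0n addr0. Qed.

Lemma normsqN z : normsq (- z) = normsq z.
Proof. by case: z => [a b]; rewrite /normsq /= !sqrrN. Qed.

Lemma normsq_par z w : normsq (z + w) + normsq (z - w) = 2 * (normsq z + normsq w).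
Proof. by case: z w => [a b] [c d]; rewrite /normsq /=; ring. Qed.

Lemma normsq_eq0 z : (normsq z == 0) = (z == 0).
Proof.
case: z => [a b]; rewrite /normsq /= paddr_eq0 ?sqr_ge0// !sqrf_eq0.
by rewrite eq_complex.
Qed.

Lemma normsq_eq1 z : (normsq z = 1) <-> (`|z| = 1).
Proof.
have sq := normsq_ge0 z; case: z sq => [a b] sq; rewrite normc_def /=.
split=> [|[]] h; first by rewrite -/(normsq (Complex a b)) h sqrtr1.
by rewrite -[LHS]sqr_sqrtr// /normsq /= h expr1n.
Qed.

Lemma normsqV z : normsq z = 1 -> normsq z^-1 = 1.
Proof.
move=> z1; have zn0 : z != 0 by rewrite -normsq_eq0 z1 oner_eq0.
by have := normsqM z z^-1; rewrite divff// normsq1 z1 mul1r.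
Qed.

End complex_normsq.

(** The limit is the supremum of the [t] with [t <= r i] for almost all [i]; beyond it, the
    ultrafilter contains the complement. *)
Lemma ultra_lim (R : realType) (I : Type) (U : set_system I) (r : I -> R) :
  UltraFilter U -> (forall i, `|r i| <= 1) ->
  exists l, forall e, 0 < e -> U [set i | `|r i - l| <= e].
Proof.
move=> UU r1; have PU : ProperFilter U by exact: ultra_proper.
pose S := [set t | U [set i | t <= r i]].
have r1' i : -1 <= r i <= 1 by rewrite -ler_norml.
have SN1 : S (-1) by apply: filterS (@filterT _ U _) => i _; case/andP: (r1' i).
have S1 t : S t -> t <= 1.
  by move=> /filter_ex[i /= ti]; case/andP: (r1' i) => _; exact: le_trans.
have hsS : has_sup S by split; [exists (-1)|exists 1 => t /S1].
exists (sup S) => e e0.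
have [t St te] := sup_adherent e0 hsS.
have nS : ~ S (sup S + e) by move=> /(ub_le_sup hsS.2); rewrite gerDl leNgt e0.
have [//|Ulow] := in_ultra_setVsetC [set i | sup S + e <= r i] UU.
apply: filterS (filterI St Ulow) => i /= [tr /negP]; rewrite -ltNge => rs.
by rewrite ler_distl; apply/andP; split; lra.
Qed.

(** * Quadratic forms invariant under a commutative group of operators *)

Section quadratic_form.
Context (R : realType) (G : zmodType) (V : lmodType R[i]) (D : set V) (T : G -> V -> V).
Hypotheses (DD : forall u v, D u -> D v -> D (u + v))
           (DZ : forall (l : R[i]) u, D u -> D (l *: u))
           (DT : forall y u, D u -> D (T y u)).
Hypotheses (TD : forall y u v, T y (u + v) = T y u + T y v)
           (TZ : forall y (l : R[i]) u, T y (l *: u) = l *: T y u)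
             (TT : forall y z u, T y (T z u) = T (y + z) u).

(** The square of an invariant Hilbert seminorm, described by the parallelogram law instead of an
    inner product. *)
Record quadratic_form (Q : V -> R) : Prop := {
  qf_ge0 : forall u, D u -> 0 <= Q u;
  qf_par : forall u v, D u -> D v -> Q (u + v) + Q (u - v) = 2 * (Q u + Q v);
  qfZ : forall l u, D u -> Q (l *: u) = normsq l * Q u;
  qfT : forall y u, D u -> Q (T y u) = Q u }.

Let DN u : D u -> D (- u). Proof. by rewrite -scaleN1r; exact: DZ. Qed.

Let DB u v : D u -> D v -> D (u - v). Proof. by move=> Du /DN; exact: DD. Qed.

Lemma quadratic_formD P Q : quadratic_form P -> quadratic_form Q ->
  quadratic_form (fun u => P u + Q u).
Proof.
move=> qP qQ; split.
- by move=> u Du; rewrite addr_ge0// ?(qf_ge0 qP)// (qf_ge0 qQ).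
- by move=> u v Du Dv; rewrite addrACA (qf_par qP)// (qf_par qQ)//; ring.
- by move=> l u Du; rewrite (qfZ qP)// (qfZ qQ)// mulrDr.
- by move=> y u Du; rewrite (qfT qP)// (qfT qQ).
Qed.

Lemma quadratic_form_comp Q (L : V -> V) : quadratic_form Q ->
  (forall u, D u -> D (L u)) ->
  (forall u v, D u -> D v -> L (u + v) = L u + L v) ->
  (forall l u, D u -> L (l *: u) = l *: L u) ->
  (forall y u, D u -> L (T y u) = T y (L u)) ->
  quadratic_form (Q \o L).
Proof.
move=> qQ DL LD LZ LT; split=> /=.
- by move=> u Du; exact/(qf_ge0 qQ)/DL.
- move=> u v Du Dv; rewrite -(qf_par qQ (DL u Du) (DL v Dv)) !LD//; last exact: DN.
  by rewrite -(scaleN1r v) LZ// scaleN1r.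
- by move=> l u Du; rewrite LZ// (qfZ qQ)//; exact: DL.
- by move=> y u Du; rewrite LT// (qfT qQ)//; exact: DL.
Qed.

Let TN z u : T z (- u) = - T z u. Proof. by rewrite -scaleN1r TZ scaleN1r. Qed.

(** The operators [T y] commute, so the defect of an eigenvector equation is again an invariant
    form; it can thus be added to the form [E] of the lemmas below. *)
Lemma quadratic_form_eigen Q y l : quadratic_form Q ->
  quadratic_form (fun u => Q (T y u - l *: u)).
Proof.
move=> qQ; apply: (quadratic_form_comp (L := fun u => T y u - l *: u) qQ).
- by move=> u Du; apply: DB; [exact: DT|exact: DZ].
- by move=> u v _ _; rewrite TD scalerDr opprD addrACA.
- by move=> m u _; rewrite TZ scalerBr !scalerA mulrC.
- by move=> z u _; rewrite TD TN TZ !TT [z + y]addrC.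
Qed.

Lemma qf_leD Q u v : quadratic_form Q -> D u -> D v -> Q (u + v) <= 2 * (Q u + Q v).
Proof.
move=> qQ Du Dv; rewrite -(qf_par qQ)// lerDl; exact/(qf_ge0 qQ)/DB.
Qed.

Lemma qfN Q u : quadratic_form Q -> D u -> Q (- u) = Q u.
Proof. by move=> qQ Du; rewrite -scaleN1r (qfZ qQ)// normsqN normsq1 mul1r. Qed.

(* One of the two vectors [u + nu^-1 T u], [u - nu^-1 T u], with [nu ^ 2 = mu],
   has the required property, by the parallelogram law. *)
Lemma halve_eigen Q E u y mu (c k : R) : quadratic_form Q -> quadratic_form E ->
  D u -> 0 < Q u -> normsq mu = 1 -> 0 <= c ->
  E u + c * Q (T (y + y) u - mu *: u) <= k * Q u ->
  exists w nu, [/\ D w, 0 < Q w, normsq nu = 1 &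
    E w + 2 * c * Q (T y w - nu *: w) <= k * Q w].
Proof.
move=> qQ qE Du Qu mu1 c0 le_k; pose nu := sqrtc mu.
have nu2 : nu * nu = mu by rewrite -expr2 sqr_sqrtc.
have nu1 : normsq nu = 1.
  apply/eqP; rewrite -(@eqrXn2 _ 2)// ?normsq_ge0 ?ler01// expr1n expr2.
  by rewrite -normsqM nu2 mu1.
have nun0 : nu != 0 by rewrite -normsq_eq0 nu1 oner_eq0.
pose v := nu^-1 *: T y u.
have Dv : D v by apply/DZ/DT.
have Qv P : quadratic_form P -> P v = P u.
  by move=> qP; rewrite (qfZ qP) ?normsqV ?mul1r ?(qfT qP)//; exact: DT.
have DL z l w : D w -> D (T z w - l *: w).
  by move=> Dw; apply: DB; [exact: DT|exact: DZ].
(* Both candidates inherit the defect of [u], since [T^2 - mu] factors as [(T - nu) (T + nu)]. *)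
have ewp : T y (u + v) - nu *: (u + v) = nu^-1 *: (T (y + y) u - mu *: u).
  rewrite /v TD TZ TT scalerDr scalerBr !scalerA divff// scale1r -nu2 mulKf//.
  by rewrite [T y u + _]addrC opprD addrACA subrr addr0.
have ewm : T y (u - v) - (- nu) *: (u - v) = - (nu^-1 *: (T (y + y) u - mu *: u)).
  rewrite /v TD TN TZ TT scaleNr opprK !scalerBr !scalerA divff// scale1r -nu2 mulKf//.
  by rewrite addrC addrA subrK opprB.
have QR : Q (nu^-1 *: (T (y + y) u - mu *: u)) = Q (T (y + y) u - mu *: u).
  by rewrite (qfZ qQ) ?normsqV ?mul1r//; exact: DL.
have [Dp Dm] : D (u + v) /\ D (u - v) by split; [exact: DD|exact: DB].
have parQ := qf_par qQ Du Dv; have parE := qf_par qE Du Dv.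
rewrite (Qv _ qQ) in parQ; rewrite (Qv _ qE) in parE.
have Qp := qf_ge0 qQ Dp; have Qm := qf_ge0 qQ Dm.
have Ep := qf_ge0 qE Dp; have Em := qf_ge0 qE Dm.
have q0 := qf_ge0 qQ (DL (y + y) mu u Du).
set q := Q (T (y + y) u - mu *: u) in le_k q0.
have cq0 : 0 <= c * q by exact: mulr_ge0.
(* By the parallelogram laws of [Q] and [E], four times the hypothesis is the sum of the two
   inequalities in [good (u + v)] and [good (u - v)], so one of them holds; the rest ensures that
   [Q] is positive there. *)
pose good w := 0 < Q w /\ E w + 2 * c * q <= k * Q w.
suff [[Q0 le]|[Q0 le]] : good (u + v) \/ good (u - v).
- by exists (u + v), nu; split=> //; rewrite ewp QR.
- exists (u - v), (- nu); split; rewrite ?normsqN// ewm (qfN qQ) ?QR//.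
  exact/DZ/DL.
have kparQ := congr1 ( *%R k) parQ; rewrite /good.
have [Qp0|Qp0] := ltrP 0 (Q (u + v)); last first.
  right; have Qp00 : Q (u + v) = 0 by lra.
  by rewrite Qp00 in parQ kparQ; split; [lra|nra].
have [Ap|Ap] := lerP (E (u + v) + 2 * c * q) (k * Q (u + v)); first by left.
right; split; last by nra.
rewrite lt_neqAle Qm andbT; apply/eqP => Qm0.
by rewrite -Qm0 in kparQ; nra.
Qed.

(** For [T^(2^n)] and the eigenvalue 1 the defect of [u] is at most [4 * Q u], so with weight
    [e / 4] it costs at most [e * Q u]. Each of the [n] halvings doubles the weight, which finally
    exceeds 1. *)
Lemma approx_eigen Q E u y (e : R) : quadratic_form Q -> quadratic_form E ->
  D u -> 0 < Q u -> 0 < e -> E u <= e * Q u ->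
  exists w nu, [/\ D w, 0 < Q w, normsq nu = 1 &
    E w + Q (T y w - nu *: w) <= 2 * e * Q w].
Proof.
move=> qQ qE Du Qu e0 Eu.
have iter_halve n c k v mu : D v -> 0 < Q v -> normsq mu = 1 -> 0 <= c ->
    E v + c * Q (T (y *+ 2 ^ n) v - mu *: v) <= k * Q v ->
    exists w nu, [/\ D w, 0 < Q w, normsq nu = 1 &
      E w + 2 ^+ n * c * Q (T y w - nu *: w) <= k * Q w].
  elim: n c v mu => [|n IH] c v mu Dv Qv mu1 c0 le_k.
    by exists v, mu; rewrite mul1r.
  rewrite expnS mul2n -addnn mulrnDr in le_k.
  have [w [nu [Dw Qw nu1 lew]]] := halve_eigen qQ qE Dv Qv mu1 c0 le_k.
  by rewrite exprSr -mulrA; apply: IH lew => //; rewrite mulr_ge0.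
pose n := (Num.truncn (4 / e)).+1.
have en : 1 <= 2 ^+ n * (e / 4).
  rewrite mulrA ler_pdivlMr// mul1r -ler_pdivrMr//.
  have /ltW/le_trans-> // : 4 / e < n%:R by rewrite truncnS_gt// divr_ge0// ltW.
  by rewrite -natrX ler_nat ltnW// ltn_expl.
have Q4 : Q (T (y *+ 2 ^ n) u - 1 *: u) <= 4 * Q u.
  rewrite scale1r; have DTu := DT (y *+ 2 ^ n) Du.
  by have := qf_leD qQ DTu (DN Du); rewrite (qfN qQ)// (qfT qQ)//; lra.
have e40 : 0 <= e / 4 by rewrite divr_ge0// ltW.
have [|w [nu [Dw Qw nu1 lew]]] := iter_halve n (e / 4) (2 * e) u 1 Du Qu (normsq1 R) e40.
  have := ler_wpM2l e40 Q4; lra.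
exists w, nu; split=> //; apply: le_trans lew; rewrite lerD2l ler_peMl//.
by apply: (qf_ge0 qQ); apply: DB; [exact: DT|exact: DZ].
Qed.

(** The defects already controlled are added to [E], so that treating one more translation keeps
    them small; starting from [e / 2] absorbs the factor 2 lost at each step. *)
Lemma joint_approx_eigen Q E (s : seq G) : quadratic_form Q -> quadratic_form E ->
  (forall e, 0 < e -> exists u, [/\ D u, 0 < Q u & E u <= e * Q u]) ->
  forall e, 0 < e -> exists u l, [/\ D u, 0 < Q u, forall y, normsq (l y) = 1,
    E u <= e * Q u & forall y, y \in s -> Q (T y u - l y *: u) <= e * Q u].
Proof.
move=> qQ qE approx.
pose E' l s u := E u + \sum_(y <- s) Q (T y u - l y *: u).
have qE' l s' : quadratic_form (E' l s').
  rewrite /E'; elim: s' => [|y s' IH].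
    by rewrite (_ : (fun u => _) = E)//; apply/funext => u; rewrite big_nil addr0.
  rewrite (_ : (fun u => _) = fun u => E' l s' u + Q (T y u - l y *: u)).
    by apply: quadratic_formD => //; exact: quadratic_form_eigen.
  by apply/funext => u; rewrite big_cons /E' addrCA addrC.
have Qeig_ge0 (l : G -> R[i]) y u : D u -> 0 <= Q (T y u - l y *: u).
  by move=> Du; exact: qf_ge0 (quadratic_form_eigen y (l y) qQ) _ Du.
suff main s' : uniq s' -> forall e, 0 < e -> exists u l,
    [/\ D u, 0 < Q u, forall y, normsq (l y) = 1 & E' l s' u <= e * Q u].
  move=> e e0; have [u [l [Du Qu l1 le_e]]] := main _ (undup_uniq s) e e0.
  exists u, l; split=> // [|y ys]; apply: le_trans le_e; rewrite /E'.
    by rewrite lerDl sumr_ge0// => y _; exact: Qeig_ge0.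
  rewrite (big_rem y) ?mem_undup//= addrCA lerDl addr_ge0 ?(qf_ge0 qE)//.
  by rewrite sumr_ge0// => z _; exact: Qeig_ge0.
elim: s' => [_ e e0|y s' IH /= /andP[ys' us'] e e0].
  have [u [Du Qu Eu]] := approx e e0; exists u, (fun=> 1).
  by split=> // [_|]; rewrite ?normsq1// /E' big_nil addr0.
have [u [l [Du Qu l1 le_e]]] := IH us' (e / 2) ltac:(by rewrite divr_gt0).
have e20 : 0 < e / 2 by rewrite divr_gt0.
have [w [nu [Dw Qw nu1 le_w]]] := approx_eigen y qQ (qE' l s') Du Qu e20 le_e.
(* The new eigenvalue leaves the others untouched because [s'] does not contain [y]; this is why
   duplicates were removed. *)
exists w, (fun z => if z == y then nu else l z); split=> // [z|]; first by case: ifP.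
rewrite (_ : 2 * (e / 2) = e) in le_w; last by field.
apply: le_trans le_w.
rewrite /E' big_cons eqxx -addrA lerD2l [leRHS]addrC lerD2l big_seq [leRHS]big_seq.
by apply: ler_sum => z zs'; case: eqP zs' ys' => // -> ->.
Qed.

(* The approximate eigenvalues for the finite subsets of [G] converge along an
   ultrafilter. *)
Lemma limit_approx_eigen Q E : quadratic_form Q -> quadratic_form E ->
  (forall e, 0 < e -> exists u, [/\ D u, 0 < Q u & E u <= e * Q u]) ->
  exists l : G -> R[i], (forall y, normsq (l y) = 1) /\
    forall e, 0 < e -> forall s : seq G, exists u, [/\ D u, 0 < Q u,
      E u <= e * Q u & forall y, y \in s -> Q (T y u - l y *: u) <= e * Q u].
Proof.
move=> qQ qE approx.
have /choice[u uP] : forall i : seq G * nat, exists u, exists l : G -> R[i],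
    [/\ D u, 0 < Q u, forall y, normsq (l y) = 1, E u <= i.2.+1%:R^-1 * Q u &
     forall y, y \in i.1 -> Q (T y u - l y *: u) <= i.2.+1%:R^-1 * Q u].
  by move=> [s n] /=; apply: joint_approx_eigen; rewrite ?invr_gt0.
have {uP}/choice[l lP] := uP.
(* Indices are a finite list of translations and a precision; the filter of tails is refined to an
   ultrafilter. *)
pose tail (i : seq G * nat) := [set j : seq G * nat | {subset i.1 <= j.1} /\ (i.2 <= j.2)%N].
pose FI := [set A | exists i, tail i `<=` A].
have PF : ProperFilter FI.
  apply: Build_ProperFilter_ex => [A [i iA]|]; first by exists i; apply: iA; split.
  split; first by exists ([::], 0%N).
  - move=> A B [i iA] [j jB]; exists (i.1 ++ j.1, maxn i.2 j.2) => k [/= sk nk].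
    move: nk; rewrite geq_max => /andP[ik jk].
    by split; [apply: iA|apply: jB]; split=> // y yi; apply: sk; rewrite mem_cat yi ?orbT.
  - by move=> A B AB [i iA]; exists i; exact: subset_trans AB.
have [U [UU FU]] := ultraFilterLemma PF.
have PU : ProperFilter U by exact: ultra_proper.
have le1 i y : `|complex.Re (l i y)| <= 1 /\ `|complex.Im (l i y)| <= 1.
  have [_ _ /(_ y) l1 _ _] := lP i; rewrite /normsq in l1.
  by split; rewrite ler_norml; apply/andP; split; nra.
have /choice[lr lrP] : forall y, exists c : R, forall e, 0 < e ->
    U [set i | `|complex.Re (l i y) - c| <= e].
  by move=> y; apply: ultra_lim => i; case: (le1 i y).
have /choice[li liP] : forall y, exists c : R, forall e, 0 < e ->
    U [set i | `|complex.Im (l i y) - c| <= e].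
  by move=> y; apply: ultra_lim => i; case: (le1 i y).
pose L y := Complex (lr y) (li y).
have near_l y e : 0 < e -> U [set i | `|complex.Re (l i y) - lr y| <= e /\
    `|complex.Im (l i y) - li y| <= e].
  by move=> e0; exact: filterI (lrP y e e0) (liP y e e0).
exists L; split=> [y|e e0 s].
  apply/eqP; rewrite -subr_eq0 -normr_le0; apply/ler_addgt0Pl => e e0; rewrite addr0.
  (* Each coordinate has modulus at most 1, so its square moves by at most [3 * d]. *)
  pose d := Num.min 1 (e / 6).
  have d0 : 0 < d by rewrite lt_min ltr01 divr_gt0.
  have [d1 de] : d <= 1 /\ d <= e / 6 by split; rewrite ge_min lexx ?orbT.
  have [i [/= Re_i Im_i]] := filter_ex (near_l y d d0).
  have [_ _ /(_ y) l1 _ _] := lP i; have [R1 I1] := le1 i y.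
  rewrite /normsq /= in l1 *.
  move: Re_i Im_i R1 I1; rewrite !ler_norml => /andP[? ?] /andP[? ?] /andP[? ?] /andP[? ?].
  by apply/andP; split; nra.
(* Replacing [l i y] by its limit costs [2 * d ^+ 2 <= e / 4], and the precision leaves a defect of
   [e / 4]; [qf_leD] doubles their sum. *)
pose d := Num.min 1 (e / 8).
have d0 : 0 < d by rewrite lt_min ltr01 divr_gt0.
have [d1 de] : d <= 1 /\ d <= e / 8 by split; rewrite ge_min lexx ?orbT.
pose n := Num.truncn (4 / e).
have ne : n.+1%:R^-1 <= e / 4.
  rewrite -[e / 4]invrK invf_div lef_pV2 ?posrE ?ltr0n ?divr_gt0// ltW//.
  by rewrite truncnS_gt// divr_ge0// ltW.
have near_all (s' : seq G) : U [set i | forall y, y \in s' ->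
    `|complex.Re (l i y) - lr y| <= d /\ `|complex.Im (l i y) - li y| <= d].
  elim: s' => [|z s' IH]; first by apply: filterS (@filterT _ U _) => i _ y.
  apply: filterS (filterI (near_l z d d0) IH) => i [? ih] y.
  by rewrite inE => /predU1P[->//|]; exact: ih.
have Utail : U (tail (s, n)) by apply: FU; exists (s, n).
have [i [near_i [/= si ni]]] := filter_ex (filterI (near_all s) Utail).
have [Di Qi l1 Ei eig] := lP i.
have ie : i.2.+1%:R^-1 <= e / 4.
  by apply: le_trans ne; rewrite lef_pV2 ?posrE ?ltr0n// ler_nat.
exists (u i); split=> // [|y ys].
  by apply: (le_trans Ei); rewrite ler_wpM2r ?ltW//; apply: (le_lt_trans ie); lra.
have -> : T y (u i) - L y *: u i = (T y (u i) - l i y *: u i) + (l i y - L y) *: u i.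
  by rewrite scalerBl addrA subrK.
apply: (le_trans (qf_leD qQ _ _)); [|exact: DZ|].
  by apply: DB; [exact: DT|exact: DZ].
rewrite (qfZ qQ)//; have := eig y (si y ys).
have [Re_i Im_i] := near_i y ys.
have nl : normsq (l i y - L y) <= e / 4.
  have [Rei Imi] : `|complex.Re (l i y - L y)| <= d /\ `|complex.Im (l i y - L y)| <= d.
    by move: Re_i Im_i; rewrite /L; case: (l i y).
  rewrite /normsq -(real_normK (num_real (complex.Re _))).
  rewrite -(real_normK (num_real (complex.Im _))).
  by have := normr_ge0 (complex.Re (l i y - L y)); have := normr_ge0 (complex.Im (l i y - L y)); nra.
have := ler_wpM2r (ltW Qi) ie; have := ler_wpM2r (ltW Qi) nl.
set q := Q (T _ _ - _); set p := normsq _ * _; set r := _^-1 * _ => ? ? ?.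
by lra.
Qed.

(** [L] is the supremum of [P u / Q u], and [u0] makes it positive. *)
Lemma approx_maximizers Q P (M : R) u0 : quadratic_form Q -> quadratic_form P ->
  (forall u, D u -> P u <= M * Q u) -> D u0 -> 0 < P u0 ->
  exists L, [/\ 0 < L, quadratic_form (fun u => L * Q u - P u) &
    forall e, 0 < e -> exists u, [/\ D u, 0 < Q u & L * Q u - P u <= e * Q u]].
Proof.
move=> qQ qP PM Du0 Pu0.
have Q_gt0 u : D u -> 0 < P u -> 0 < Q u.
  move=> Du Pu; rewrite lt_neqAle (qf_ge0 qQ)// andbT; apply/eqP => Qu.
  by have := PM u Du; rewrite -Qu mulr0 leNgt Pu.
pose A := [set r | exists u, [/\ D u, 0 < Q u & r = P u / Q u]].
have hsA : has_sup A.
  split; first by exists (P u0 / Q u0), u0; split=> //; exact: Q_gt0.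
  by exists M => _ [u [Du Qu ->]]; rewrite ler_pdivrMr//; exact: PM.
have leL u : D u -> P u <= sup A * Q u.
  move=> Du; have Pu := qf_ge0 qP Du; have [P0|Pn0] := eqVneq (P u) 0.
    rewrite P0 mulr_ge0// ?(qf_ge0 qQ)//; apply: le_trans (ub_le_sup hsA.2 _); last first.
      by exists u0; split; first exact: Du0; [exact: Q_gt0|reflexivity].
    by rewrite divr_ge0// ?(qf_ge0 qQ)// ltW.
  have Qu : 0 < Q u by apply: Q_gt0 => //; rewrite lt0r Pn0.
  by rewrite -ler_pdivrMr//; apply: (ub_le_sup hsA.2); exists u.
exists (sup A); split=> [||e e0].
- have := leL u0 Du0; have Q0 := Q_gt0 u0 Du0 Pu0.
  by move=> /(lt_le_trans Pu0); rewrite pmulr_lgt0.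
- split=> [u Du|u v Du Dv|l u Du|y u Du].
  + by rewrite subr_ge0 leL.
  + rewrite addrACA -opprD -mulrDr (qf_par qQ)// (qf_par qP)//; ring.
  + rewrite (qfZ qQ)// (qfZ qP)//; ring.
  + by rewrite (qfT qQ)// (qfT qP).
- have [_ [u [Du Qu ->]] Pe] := sup_adherent e0 hsA.
  exists u; split=> //; move: Pe; rewrite ltr_pdivlMr// => /ltW.
  by rewrite mulrBl; lra.
Qed.

End quadratic_form.

(** * Separation by characters *)

Section complex_functions.
Context (R : realType) (G : zmodType) (F : set_system G).
Hypothesis lpF : locally_precompact F.
Context (J : (G -> R) -> R).
Hypothesis ipJ : invariant_positive F J.
Local Notation V := (G -> R[i]^o).
Local Notation bsupp := (@bsupp R G F).
Local Notation Re := complex.Re.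
Local Notation Im := complex.Im.
Implicit Types (u v : V) (f : G -> R).

Definition cucsupp u := ucsupp F (fun x => Re (u x)) /\ ucsupp F (fun x => Im (u x)).

Definition translate y u : V := fun x => u (x + y).

Definition energy u := J (fun x => normsq (u x)).

Lemma cucsuppD u v : cucsupp u -> cucsupp v -> cucsupp (u + v).
Proof.
move=> [ru iu] [rv iv]; split.
  rewrite (_ : (fun _ => _) = fun x => Re (u x) + Re (v x)); first exact: ucsuppD.
  by apply/funext => x; rewrite raddfD.
rewrite (_ : (fun _ => _) = fun x => Im (u x) + Im (v x)); first exact: ucsuppD.
by apply/funext => x; rewrite raddfD.
Qed.

Lemma ReM (z w : R[i]) : Re (z * w) = Re z * Re w - Im z * Im w.
Proof. by case: z w => [a b] [c d]. Qed.

Lemma ImM (z w : R[i]) : Im (z * w) = Re z * Im w + Im z * Re w.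
Proof. by case: z w => [a b] [c d]. Qed.

Lemma cucsuppZ (l : R[i]) u : cucsupp u -> cucsupp (l *: u).
Proof.
move=> [ru iu]; split.
  rewrite (_ : (fun _ => _) = fun x => Re l * Re (u x) - Im l * Im (u x)).
    by apply: ucsuppB => //; exact: ucsuppZ.
  by apply/funext => x; rewrite -ReM.
rewrite (_ : (fun _ => _) = fun x => Re l * Im (u x) + Im l * Re (u x)).
  by apply: ucsuppD => //; exact: ucsuppZ.
by apply/funext => x; rewrite -ImM.
Qed.

Lemma cucsupp_translate y u : cucsupp u -> cucsupp (translate y u).
Proof. by move=> [ru iu]; split; [exact: ucsupp_shift ru|exact: ucsupp_shift iu]. Qed.

Lemma ucsupp_normsq u : cucsupp u -> ucsupp F (fun x => normsq (u x)).
Proof. by move=> [ru iu]; apply: ucsuppD => //; exact: ucsupp_sqr. Qed.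

Lemma bsupp_normsq u : cucsupp u -> bsupp (fun x => normsq (u x)).
Proof. by move=> /ucsupp_normsq/ucsupp_bsupp. Qed.

Lemma cucsuppB u v : cucsupp u -> cucsupp v -> cucsupp (u - v).
Proof. by move=> du dv; rewrite -scaleN1r; apply: cucsuppD => //; exact: cucsuppZ. Qed.

Lemma quadratic_form_energy : quadratic_form cucsupp translate energy.
Proof.
split=> [u du|u v du dv|l u du|y u du].
- by apply: (ip_ge0 ipJ) => [|x]; [exact: bsupp_normsq|exact: normsq_ge0].
- have [bu bv] := (bsupp_normsq du, bsupp_normsq dv).
  rewrite /energy -(ipD ipJ bu bv) -(ipZ ipJ _ (bsuppD bu bv)).
  rewrite -(ipD ipJ (bsupp_normsq (cucsuppD du dv)) (bsupp_normsq (cucsuppB du dv))).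
  by congr J; apply/funext => x; exact: normsq_par.
- rewrite /energy -(ipZ ipJ); last exact: bsupp_normsq.
  by congr J; apply/funext => x; exact: normsqM.
- exact: (ip_shift ipJ y (bsupp_normsq du)).
Qed.

(** Taken coordinatewise, since [J] acts on real functions. *)
Definition cconvol f u : V :=
  fun x => Complex (convol J f (fun y => Re (u y)) x) (convol J f (fun y => Im (u y)) x).

Lemma cucsupp_cconvol f u : bsupp f -> cucsupp u -> cucsupp (cconvol f u).
Proof. by move=> bf [ru iu]; split; exact: ucsupp_convol. Qed.

Lemma energyE u : cucsupp u ->
  energy u = J (fun x => Re (u x) ^+ 2) + J (fun x => Im (u x) ^+ 2).
Proof. by move=> [ru iu]; apply: (ipD ipJ); exact/ucsupp_bsupp/ucsupp_sqr. Qed.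

Lemma energy_cconvol f u : bsupp f -> cucsupp u ->
  energy (cconvol f u) <= J (fun x => `|f x|) ^+ 2 * energy u.
Proof.
move=> bf du; rewrite !energyE//; last exact: cucsupp_cconvol.
by case: du => ru iu; rewrite mulrDr lerD// (ip_convol_sqr lpF ipJ).
Qed.

Lemma cconvolD f u v : bsupp f -> cucsupp u -> cucsupp v -> cconvol f (u + v) = cconvol f u + cconvol f v.
Proof.
move=> bf [/ucsupp_bounded ru /ucsupp_bounded iu] [/ucsupp_bounded rv /ucsupp_bounded iv].
apply/funext => x; rewrite /cconvol.
transitivity (Complex (convol J f (fun y => Re (u y)) x + convol J f (fun y => Re (v y)) x)
  (convol J f (fun y => Im (u y)) x + convol J f (fun y => Im (v y)) x)); last by [].
congr Complex; rewrite -(convolDr ipJ)//; congr convol; apply/funext => y; rewrite raddfD//.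
Qed.

Lemma cconvolZ f (l : R[i]) u : bsupp f -> cucsupp u -> cconvol f (l *: u) = l *: cconvol f u.
Proof.
move=> bf [/ucsupp_bounded ru /ucsupp_bounded iu].
have bZ (h : G -> R) (t : R) : bounded_fun_on h -> bounded_fun_on (fun x => t * h x).
  by move=> [M hM]; exists (`|t| * M) => x; rewrite normrM ler_wpM2l.
apply/funext => x; rewrite /cconvol.
transitivity (Complex (Re l * convol J f (fun y => Re (u y)) x +
    - Im l * convol J f (fun y => Im (u y)) x)
  (Re l * convol J f (fun y => Im (u y)) x + Im l * convol J f (fun y => Re (u y)) x)).
  congr Complex; rewrite -!(convolZr ipJ)// -(convolDr ipJ) ?bZ//; try exact: bZ.
    by congr convol; apply/funext => y; rewrite mulNr -ReM.
  by congr convol; apply/funext => y; rewrite -ImM.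
by apply/eqP; rewrite eq_complex /=; case: (l) => a b /=; rewrite mulNr !eqxx.
Qed.

Lemma cconvol_translate f y u : cconvol f (translate y u) = translate y (cconvol f u).
Proof. by apply/funext => x; rewrite /cconvol /translate -!convol_shiftr. Qed.

(** The translation moves from [u] to [f]. Hence translates of [cconvol f u] vary with the modulus
    of continuity of [f], whatever [u] is. *)
Lemma translate_cconvol f y u : bsupp f -> cucsupp u ->
  translate y (cconvol f u) - cconvol f u = cconvol (fun x => f (x + y) - f x) u.
Proof.
move=> bf [/ucsupp_bounded ru /ucsupp_bounded iu]; have bs := bsupp_shift lpF y bf.
apply/funext => x; rewrite /cconvol /translate.
rewrite !(convolDl ipJ _ bs (bsuppN bf))//= !(convolNl ipJ)//= !(convol_shiftl ipJ)//.
Qed.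

End complex_functions.

(** The integrand is [f y * f (- y)], which is at least [1 / 4] near 0. *)
Lemma convol_self_gt0 (R : realType) (G : zmodType) (F : set_system G)
  (J : (G -> R) -> R) (f : G -> R) : locally_precompact F -> invariant_positive F J ->
  ucsupp F f -> (forall x, 0 <= f x) -> f 0 = 1 -> 0 < convol J f f 0.
Proof.
move=> lpF ipJ gf f0 f1; have [N FN fN] := gf.2 (1 / 2) ltac:(by rewrite divr_gt0).
have [N' FN' N'B] := lpB lpF FN; have N'0 := lp0 lpF FN'.
have f_ge y : N y -> 1 / 2 <= f y.
  by move=> Ny; have := fN 0 y Ny; rewrite add0r f1 ler_norml => /andP[]; lra.
have q0 : 0 < 1 / 4 :> R by rewrite divr_gt0.
apply: (@ip_gt0 _ _ _ lpF _ ipJ _ N' 0 (1 / 4)) => //.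
- by apply: bsupp_convol_kernel; [exact: ucsupp_bsupp|exact: ucsupp_bounded gf].
- by move=> x; rewrite mulr_ge0.
move=> v Nv; rewrite add0r sub0r.
have Nv1 : N v by rewrite -[v]subr0; exact: N'B.
have Nv2 : N (- v) by rewrite -[- v]sub0r; exact: N'B.
have := ler_pM _ _ (f_ge _ Nv1) (f_ge _ Nv2); rewrite !divr_ge0// => /(_ isT isT).
by apply: le_trans; lra.
Qed.

Theorem character_separation (R : realType) (G : zmodType) (F : set_system G)
  (N : set G) (a : G) : locally_precompact F -> F N -> ~ N a ->
  exists chi : G -> R[i], [/\ {morph chi : x y / x + y >-> x * y},
    forall x, normsq (chi x) = 1,
    forall e : R, 0 < e -> exists2 N', F N' & forall z, N' z -> normsq (chi z - 1) <= e &
    chi a != 1].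
Proof.
move=> lpF FN Na; have [J ipJ] := invariant_positive_exists R lpF.
have [N1 FN1 N1D] := lpD lpF FN; have [K FK tK] := lpK lpF.
(* The support lies in [N1] so that the convolution of [f] with itself vanishes at [a], and in [K]
   so that it is totally bounded. *)
have [f [f1 f0 fN ucf]] := bump_function R lpF (@filterI _ _ (lp_filter lpF) _ _ FN1 FK).
have gf : ucsupp F f.
  split=> //; split; last by apply: tb_sub tK => x /fN[].
  have [N2 FN2 fN2] := ucf 1 ltr01; have [s sK] := tK N2 FN2.
  (* Each point of [K] is close to some [y] in [s], and [f] grows by at most 1 from there. *)
  exists (\sum_(y <- s) f y + 1) => x; rewrite ger0_norm//.
  have [->|/fN[_ Kx]] := eqVneq (f x) 0; first by rewrite addr_ge0// sumr_ge0.
  have [y ys Nxy] := sK x Kx; have := fN2 y (x - y) Nxy.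
  rewrite [y + _]addrC subrK (big_rem y ys)/= ler_norml => /andP[_ fxy].
  have : 0 <= \sum_(z <- rem y s) f z by apply: sumr_ge0 => z _; exact: f0.
  by lra.
have bf := ucsupp_bsupp gf; have bnf := bsupp_norm bf.
pose D := @cucsupp R G F; pose T := @translate R G; pose Q := energy J.
have qQ : quadratic_form D T Q := quadratic_form_energy lpF ipJ.
have DB u v : D u -> D v -> D (u - v) by exact: cucsuppB.
have DT y u : D u -> D (T y u) by exact: cucsupp_translate.
have TB y u v : T y (u - v) = T y u - T y v by [].
pose S u := cconvol J f (T a u - u).
have DS u : D u -> D (S u) by move=> Du; apply: cucsupp_cconvol => //; apply: DB => //; exact: DT.
have SD u v : D u -> D v -> S (u + v) = S u + S v.
  move=> Du Dv; rewrite /S -(cconvolD ipJ)//; try by apply: DB => //; exact: DT.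
  by congr cconvol; rewrite opprD addrACA.
have SZ l u : D u -> S (l *: u) = l *: S u.
  move=> Du; rewrite /S -(cconvolZ ipJ)//; last by apply: DB => //; exact: DT.
  by congr cconvol; rewrite scalerBr.
have TT y z u : T y (T z u) = T (y + z) u.
  by apply/funext => x; rewrite /T /translate addrA.
have ST y u : S (T y u) = T y (S u).
  rewrite /S -[RHS](cconvol_translate J f y) -/T TB; congr (cconvol _ _ (_ - _)).
  by rewrite TT addrC -TT.
have qP : quadratic_form D T (Q \o S).
  by apply: quadratic_form_comp => //; exact: cucsuppZ.
pose Jf := J (fun x => `|f x|).
have QS u : D u -> Q (S u) <= Jf ^+ 2 * Q (T a u - u).
  by move=> Du; apply: (energy_cconvol lpF ipJ) => //; apply: DB => //; exact: DT.
have QB u v : D u -> D v -> Q (u - v) <= 2 * (Q u + Q v).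
  move=> Du Dv; rewrite -(qf_par qQ)// lerDr; apply: (qf_ge0 qQ); exact: cucsuppD.
have QST u : D u -> Q (S u) <= 4 * Jf ^+ 2 * Q u.
  move=> Du; apply: (le_trans (QS u Du)).
  have := ler_wpM2l (sqr_ge0 Jf) (QB _ _ (DT a u Du) Du); rewrite (qfT qQ)//.
  by move=> h; apply: (le_trans h); lra.
pose u0 : G -> R[i]^o := fun x => Complex (f x) 0.
have Du0 : D u0 by split => //; exact: ucsupp0.
have Su0 : 0 < Q (S u0).
  have faE : convol J f f a = 0.
    rewrite -[RHS](ip0 ipJ); congr J; apply/funext => y; apply/eqP.
    rewrite mulf_eq0; apply/norP => -[/fN[Ny _] /fN[Nay _]].
    by apply: Na; rewrite -(subrK y a); exact: N1D.
  (* At 0 only the convolution without translation survives, and it is positive; by continuity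
     [S u0] is nonzero on a neighbourhood. *)
  have DSu0 := DS u0 Du0; have gn := ucsupp_normsq lpF DSu0.
  have SE : complex.Re (S u0 0) = - convol J f f 0.
    transitivity (convol J f (fun y => f (y + a) + -1 * f y) 0).
      by congr convol; apply/funext => y; rewrite mulN1r.
    have bdf := ucsupp_bounded gf; have bda := ucsupp_bounded (ucsupp_shift lpF a gf).
    rewrite (convolDr ipJ)//; last exact: ucsupp_bounded (ucsuppZ (-1) gf).
    by rewrite (convolZr ipJ)// convol_shiftr add0r faE add0r mulN1r.
  have c0 := convol_self_gt0 lpF ipJ gf f0 f1; set c := convol J f f 0 in SE c0.
  have [N2 FN2 N2n] := gn.2 (c ^+ 2 / 2) ltac:(by rewrite divr_gt0 ?exprn_gt0).
  apply: (ip_gt0 lpF ipJ (ucsupp_bsupp gn) _ FN2 (x0 := 0) (c := c ^+ 2 / 2)).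
  - by move=> x; exact: normsq_ge0.
  - by rewrite divr_gt0 ?exprn_gt0.
  move=> v /(N2n 0); rewrite ler_norml => /andP[+ _].
  have : c ^+ 2 <= normsq (S u0 0) by rewrite /normsq SE sqrrN lerDl sqr_ge0.
  by lra.
have [L [L0 qE approx]] := approx_maximizers qQ qP QST Du0 Su0.
have [chi [chi1 chiP]] : exists l : G -> R[i], (forall y, normsq (l y) = 1) /\
    forall e, 0 < e -> forall s : seq G, exists u, [/\ D u, 0 < Q u,
      L * Q u - Q (S u) <= e * Q u &
      forall y, y \in s -> Q (T y u - l y *: u) <= e * Q u].
  by apply: limit_approx_eigen qQ qE approx => //; [exact: cucsuppD|exact: cucsuppZ].
have arch (c C : R) : 0 <= C -> (forall e, 0 < e -> c <= C * e) -> c <= 0.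
  move=> C0 cC; rewrite leNgt; apply/negP => cp.
  have C1 : 0 < C + 1 by lra.
  have := cC (c / (2 * (C + 1))) ltac:(by rewrite divr_gt0// mulr_gt0).
  have -> : C * (c / (2 * (C + 1))) = c * (C / (C + 1)) / 2 by field; lra.
  have : C / (C + 1) <= 1 by rewrite ler_pdivrMr// mul1r lerDl.
  by move=> /(ler_wpM2l (ltW cp)); lra.
have Deig y u : D u -> D (T y u - chi y *: u).
  by move=> Du; apply: DB; [exact: DT|exact: cucsuppZ].
have QD u v : D u -> D v -> Q (u + v) <= 2 * (Q u + Q v).
  by move=> Du Dv; apply: qf_leD qQ Du Dv => //; [exact: cucsuppD|exact: cucsuppZ].
have chi1le z : normsq (chi z - 1) <= 4.
  have := normsq_par (chi z) 1; rewrite chi1 normsq1.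
  by have := normsq_ge0 (chi z + 1); lra.
exists chi; split=> //.
- move=> y z; apply/eqP; rewrite -subr_eq0 -normsq_eq0 eq_le normsq_ge0 andbT.
  (* [d *: u] is a combination of three eigenvector defects, each at most [e * Q u]; the two uses of
     the parallelogram law give [2 * (2 * (e + e) + e)]. *)
  apply: (arch _ 10) => // e e0; set d := _ - _.
  have [u [Du Qu _ eig]] := chiP e e0 [:: y; z; y + z].
  have dE : d *: u = T y (T z u - chi z *: u) + chi z *: (T y u - chi y *: u) -
      (T (y + z) u - chi (y + z) *: u).
    rewrite TB TT scalerBr addrA [T y (_ *: u)]/= subrK scalerA opprB [RHS]addrC.
    by rewrite addrA subrK /d scalerBl [chi z * _]mulrC.
  rewrite -(ler_pM2r Qu) -(qfZ qQ)// dE.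
  have [DA DC] := (DT y _ (Deig z u Du), cucsuppZ lpF (chi z) (Deig y u Du)).
  apply: (le_trans (QB _ _ (cucsuppD lpF DA DC) (Deig (y + z) u Du))).
  have := QD _ _ DA DC; rewrite (qfT qQ) ?(qfZ qQ) ?chi1 ?mul1r//; try exact: Deig.
  have := eig y; have := eig z; have := eig (y + z).
  rewrite !inE !eqxx !orbT => /(_ isT) ? /(_ isT) ? /(_ isT) ? ?.
  lra.
- move=> e e0.
  (* [B] contains the supports of all the functions [f (. + z) - f] with [z] in [K], so a uniform
     bound on them bounds their integrals. *)
  pose B := [set x | f x != 0] `|` [set x + k | x in [set x | f x != 0] & k in [set - k | k in K]].
  have tB : totally_bounded F B.
    by apply: tbU; [exact: bf.2|apply: tbD => //; [exact: bf.2|exact: tbN]].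
  pose MB := J (fun x => (x \in B)%:R); have MB0 : 0 <= MB.
    by apply: (ip_ge0 ipJ) => //; exact: bsupp_ind.
  pose t := Num.min 1 (e * L / 8).
  have t0 : 0 < t by rewrite lt_min ltr01 divr_gt0// mulr_gt0.
  have [t1 te] : t <= 1 /\ t <= e * L / 8 by split; rewrite ge_min lexx ?orbT.
  have MB1 : 0 < MB + 1 by lra.
  have [N2 FN2 fN2] := ucf (t / (MB + 1)) ltac:(by rewrite divr_gt0).
  exists (N2 `&` K); first exact: (@filterI _ _ (lp_filter lpF)).
  move=> z [N2z Kz]; pose g x := f (x + z) - f x.
  have bg : bsupp F g by apply: bsuppB => //; exact: bsupp_shift.
  pose w := J (fun x => `|g x|).
  have w0 : 0 <= w by apply: (ip_ge0 ipJ) => //; exact: bsupp_norm.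
  have wt : w <= t.
    apply: (@le_trans _ _ (t / (MB + 1) * MB)); last first.
      by rewrite mulrAC ler_pdivrMr// ler_wpM2l ?(ltW t0)// lerDl.
    rewrite -(ipZ ipJ); last exact: bsupp_ind.
    apply: (ip_le ipJ); [exact: bsupp_norm|by apply: bsuppZ; exact: bsupp_ind|move=> x].
    have [_|] := boolP (x \in B); first by rewrite mulr1; exact: fN2.
    rewrite notin_setE => nB; rewrite mulr0 /g.
    have -> : f x = 0 by apply: contra_notP nB => /eqP fx; left.
    have -> : f (x + z) = 0.
      apply: contra_notP nB => /eqP fx; right; exists (x + z) => //.
      by exists (- z); [exists z|rewrite addrK].
    by rewrite subrr normr0.
  suff le_w : normsq (chi z - 1) * L - 8 * w ^+ 2 <= 0.
    rewrite -(ler_pM2r L0); have : w ^+ 2 <= t by nra.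
    by lra.
  (* [(chi z - 1) *: S u] is the translation defect of [S u], of order [w], minus the image under
     [S] of the eigenvector defect of [u], whence [8 * Jf ^+ 2]. The 4 bounds [normsq (chi z - 1)]
     when [Q (S u)] is replaced by [L * Q u]. *)
  apply: (arch _ (8 * Jf ^+ 2 + 4)); first by rewrite addr_ge0// mulr_ge0// sqr_ge0.
  move=> d d0; have [u [Du Qu SL eig]] := chiP d d0 [:: z].
  have {}eig := eig z (mem_head _ _).
  have SB x y : D x -> D y -> S (x - y) = S x - S y.
    move=> Dx Dy; have -> : x - y = x + -1 *: y by rewrite scaleN1r.
    by rewrite (SD _ _ Dx (cucsuppZ lpF (-1) Dy)) SZ// scaleN1r.
  have dE : (chi z - 1) *: S u = (T z (S u) - S u) - S (T z u - chi z *: u).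
    rewrite SB; [|exact: DT|exact: cucsuppZ]; rewrite ST SZ// scalerBl scale1r.
    by rewrite opprB [RHS]addrC addrA subrK.
  have DTa : D (T a u - u) by apply: DB => //; exact: DT.
  have D1 : D (T z (S u) - S u) by apply: DB; [apply: DT; exact: DS|exact: DS].
  have Q1 : Q (T z (S u) - S u) <= w ^+ 2 * (4 * Q u).
    rewrite /S /T (translate_cconvol lpF ipJ)//.
    apply: (le_trans (energy_cconvol lpF ipJ bg DTa)); rewrite ler_wpM2l ?sqr_ge0//.
    by apply: (le_trans (QB _ _ (DT a u Du) Du)); rewrite (qfT qQ)//; lra.
  have Q2 := QST _ (Deig z u Du).
  have := QB _ _ D1 (DS _ (Deig z u Du)); rewrite -dE (qfZ qQ); last exact: DS.
  have J0 := sqr_ge0 Jf.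
  have := ler_wpM2l J0 eig => e1 e2.
  have n0 := normsq_ge0 (chi z - 1).
  have e3 := ler_wpM2l n0 SL; have e4 := ler_wpM2r (mulr_ge0 (ltW d0) (ltW Qu)) (chi1le z).
  rewrite -(ler_pM2r Qu); lra.
(* If [chi a = 1], then [T a u - u] is small, hence so is [S u], although [Q (S u)] is close to
   [L * Q u]. *)
- apply/negP => /eqP chia; suff : L <= 0 by rewrite leNgt L0.
  apply: (arch _ (Jf ^+ 2 + 1)); first by rewrite addr_ge0// sqr_ge0.
  move=> e e0; have [u [Du Qu SL eig]] := chiP e e0 [:: a].
  have {}eig := eig a (mem_head _ _); rewrite chia scale1r in eig.
  have := QS u Du; have := ler_wpM2l (sqr_ge0 Jf) eig => e1 e2.
  by rewrite -(ler_pM2r Qu); lra.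
Qed.

(** If [K] were not in the ideal [I], the sets whose complement in [K] is in [I] would form a proper
    filter; at a cluster point in [K] this contradicts the local hypothesis. It is used for finite
    covers and for null sets. *)
Lemma compact_ideal (T : topologicalType) (I : set (set T)) (K : set T) :
  I set0 -> (forall A B, A `<=` B -> I B -> I A) ->
  (forall A B, I A -> I B -> I (A `|` B)) ->
  compact K -> (forall x, K x -> exists2 U, nbhs x U & I U) -> I K.
Proof.
move=> I0 IS IU cK Kloc; apply: contrapT => nIK.
pose F := [set A | I (K `\` A)].
have FF : ProperFilter F.
  split; first by move=> F0; apply: nIK; rewrite -(setD0 K).
  split; first by rewrite /F /= setDT.
  - by move=> A B FA FB; rewrite /F /= setDIr; exact: IU.
  - by move=> A B AB; apply: IS => x [Kx nB]; split=> // /AB.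
have [p [Kp clp]] : K `&` cluster F !=set0 by apply: cK; rewrite /F /= setDv.
have [U Up IUU] := Kloc p Kp.
have FU : F (~` U) by apply: IS IUU => x [_ /contrapT].
by have [x [/=]] := clp _ _ FU Up.
Qed.

(** * Neighbourhoods in a topological group, modulo a subgroup *)

Section topological_group.
Context (G : topologicalZmodType).
Implicit Types (H U : set G).

Lemma continuous_translation (y : G) : continuous (fun x : G => x + y).
Proof.
move=> x; apply: (@continuous_comp _ _ _ (fun x : G => (x, y)) (fun z => z.1 + z.2)).
  by apply: cvg_pair => /=; [exact: cvg_id|exact: cvg_cst].
exact: add_continuous.
Qed.

Lemma nbhs_translation (x : G) U : nbhs x U -> nbhs (0 : G) [set v | U (x + v)].
Proof.
move=> Ux; have := @continuous_translation x 0; rewrite /continuous_at add0r.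
move=> /(_ U Ux) V; have {}V : nbhs (0 : G) ((fun v => v + x) @^-1` U) by [].
by apply: filterS V => v /=; rewrite addrC.
Qed.

(* The neighbourhoods of the identity in [G / H], pulled back to [G]. *)
Definition nbhs_mod H : set_system G :=
  [set N | exists2 U, nbhs (0 : G) U & forall u h, U u -> H h -> N (u + h)].

Lemma nbhs_sub (U : set G) : nbhs (0 : G) U ->
  exists2 V, nbhs (0 : G) V & forall x y, V x -> V y -> U (x - y).
Proof.
move=> U0; have := @sub_continuous G (0, 0); rewrite /continuous_at/= subrr.
move=> /(_ U U0)[[A B] [/= A0 B0] ABU]; exists (A `&` B); first exact: filterI.
by move=> x y [Ax _] [_ By]; exact: (ABU (x, y)).
Qed.

Lemma compact_totally_bounded (K U : set G) : compact K -> nbhs (0 : G) U ->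
  exists s : seq G, forall x, K x -> exists2 y, y \in s & U (x - y).
Proof.
move=> cK U0.
apply: (compact_ideal (I := [set A | exists s : seq G,
  forall x, A x -> exists2 y, y \in s & U (x - y)]) _ _ _ cK).
- by exists [::].
- by move=> A B AB [s sB]; exists s => x /AB/sB.
- move=> A B [s sA] [t tB]; exists (s ++ t) => x.
  by move=> [/sA|/tB][y yst Uxy]; exists y; rewrite // mem_cat yst ?orbT.
move=> x _; exists [set t | U (t - x)].
  have := @continuous_translation (- x) x; rewrite /continuous_at subrr.
  by move=> /(_ U U0).
by exists [:: x] => t Utx; exists x; rewrite ?mem_head.
Qed.

Lemma locally_precompact_nbhs_mod H : locally_compact [set: G] ->
  GRing.zmod_closed [in H] -> locally_precompact (nbhs_mod H).
Proof.
move=> lcG [H0 HB]; have {}H0 : H 0 by rewrite -in_setE.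
have {}HB x y : H x -> H y -> H (x - y).
  by move=> Hx Hy; rewrite -in_setE; apply: HB; rewrite inE.
split.
- split; first by exists setT => //; exact: filterT.
  + move=> A B [U U0 UA] [V V0 VB]; exists (U `&` V); first exact: filterI.
    by move=> u h [Uu Vu] Hh; split; [exact: UA|exact: VB].
  + by move=> A B AB [U U0 UA]; exists U => // u h Uu Hh; exact/AB/UA.
- by move=> N [U U0 UN]; rewrite -[0]addr0; apply: UN => //; exact: nbhs_singleton.
- move=> N [U U0 UN]; have [V V0 VU] := nbhs_sub U0.
  exists [set x | exists u h, [/\ V u, H h & x = u + h]].
    by exists V => // u h Vu Hh; exists u, h.
  move=> _ _ [u [h [Vu Hh ->]]] [v [k [Vv Hk ->]]].
  by rewrite opprD addrACA; apply: UN; [exact: VU|exact: HB].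
- have [K K0 [cK _]] := lcG 0 I.
  exists [set x | exists u h, [/\ K u, H h & x = u + h]].
    exists K => [|u h Ku Hh]; last by exists u, h.
    have {}K0 : nbhs (0 : G) [set x | setT x -> K x] by [].
    by apply: filterS K0 => x; exact.
  move=> N [U U0 UN]; have [s sK] := compact_totally_bounded cK U0.
  exists s => _ [u [h [/sK[y ys Uuy] Hh ->]]]; exists y => //.
  by rewrite addrAC; exact: UN.
Qed.

(** The points [u] with [a - u] outside [H] form a neighbourhood of 0; adding [H] to it cannot
    produce [a]. *)
Lemma closed_subgroup_separation H a : closed H -> ~ H a ->
  GRing.zmod_closed [in H] -> exists2 N, nbhs_mod H N & ~ N a.
Proof.
move=> cH Ha [_ HB].
have oC : open (~` H) by exact: closed_openC.
have U0 := nbhs_translation (open_nbhs_nbhs (conj oC Ha)).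
have := @opp_continuous G 0; rewrite /continuous_at oppr0 => /(_ _ U0) V0.
exists [set x | exists u h, [/\ ~ H (a - u), H h & x = u + h]].
  by exists [set v | ~ H (a - v)] => // u h Uu Hh; exists u, h.
by move=> [u [h [nH Hh aE]]]; apply: nH; rewrite aE [u + h]addrC addrK.
Qed.

End topological_group.

Section dual.
Context (R : realType) (G : topologicalZmodType).
Local Notation Re := complex.Re.
Local Notation Im := complex.Im.

Lemma dual_group_exists (H : set G) a : locally_compact [set: G] ->
  closed_subgroup H -> ~ H a ->
  exists chi : G -> R[i], [/\ dual_group R G chi, forall x, H x -> chi x = 1 & chi a != 1].
Proof.
move=> lcG [sH cH] Ha.
have [N FN Na] := closed_subgroup_separation cH Ha sH.
have [chi [chiD chi1 chi_cont chia]] :=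
  character_separation R (locally_precompact_nbhs_mod lcG sH) FN Na.
have chin0 x : chi x != 0 by rewrite -normsq_eq0 chi1 oner_eq0.
exists chi; split=> //; last first.
  (* Every member of [nbhs_mod H] contains [H], so continuity for this filter already makes [chi]
     trivial on [H]. *)
  move=> h Hh; apply/eqP; rewrite -subr_eq0 -normsq_eq0 eq_le normsq_ge0 andbT.
  apply/ler_addgt0Pl => e e0; rewrite addr0.
  have [N' [U U0 UN'] chiN'] := chi_cont e e0.
  by apply: chiN'; rewrite -[h]add0r; apply: UN' => //; exact: nbhs_singleton.
split=> // [x|x]; first by apply/normsq_eq1; exact: chi1.
apply/cvgrPdist_lt => e; rewrite ltcE/= => /andP[/eqP Ime Ree].
have e0 : 0 < (Re e / 2) ^+ 2 by rewrite exprn_gt0// divr_gt0.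
have [N' [U U0 UN'] chiN'] := chi_cont _ e0.
have [H0 _] := sH.
have V0 : nbhs x [set t | U (t - x)].
  have := @continuous_translation G (- x) x; rewrite /continuous_at subrr.
  by move=> /(_ U U0).
apply: filterS V0 => t /= Utx.
have le_e : normsq (chi t - chi x) <= (Re e / 2) ^+ 2.
  have -> : chi t - chi x = chi x * (chi (t - x) - 1).
    by rewrite mulrBr mulr1 -chiD [x + _]addrC subrK.
  rewrite normsqM chi1 mul1r; apply: chiN'; rewrite -[t - x]addr0; apply: UN' => //.
  by rewrite -in_setE.
rewrite distrC normc_def ltcE /= Ime eqxx/=.
apply: (@le_lt_trans _ _ (Re e / 2)); last lra.
by rewrite -(ler_sqr (y := Re e / 2)) ?nnegrE ?sqrtr_ge0// ?sqr_sqrtr ?normsq_ge0//; lra.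
Qed.

End dual.

(** * The support of a probability *)

Section support.
Context (R : realType) (G : topologicalZmodType) (mu : probability (borel G) R).
Local Notation Re := complex.Re.
Local Notation Im := complex.Im.

Lemma open_measurable_borel (U : set G) : open U -> measurable (U : set (borel G)).
Proof. exact: sub_sigma_algebra. Qed.

Lemma open_setC_supp : open (~` supp mu).
Proof.
rewrite openE => x; apply: contra_notP => nx U oU Ux.
rewrite lt0e measure_ge0 andbT; apply/eqP => U0; apply: nx.
rewrite /interior nbhsE; exists U => //= y Uy sy.
by have := sy U oU Uy; rewrite U0 ltxx.
Qed.

(** By inner regularity it is enough to treat compact subsets of the complement, which are locally
    contained in null open sets. The Hausdorff property makes them closed, hence Borel. *)
Lemma measure_setC_supp : hausdorff_space G -> regular_measure mu ->
  mu (~` supp mu) = 0%E.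
Proof.
move=> hausG regmu; have mC := open_measurable_borel open_setC_supp.
have [_ ->] := regmu _ mC; apply/eqP; rewrite eq_le; apply/andP; split; last first.
  by apply: ereal_sup_ubound; exists set0 => //=; split; [exact: compact0|].
apply: ge_ereal_sup => _ [K [cK KC] <-].
have mK : measurable (K : set (borel G)).
  rewrite -[K]setCK; apply: measurableC; apply: open_measurable_borel.
  by apply: closed_openC; exact: compact_closed.
suff : mu.-negligible K by move=> /(measure_negligible mK) ->.
apply: (compact_ideal (I := fun A : set G => mu.-negligible A) _ _ _ cK).
- exact: negligible_set0.
- by move=> A B AB; exact: negligibleS.
- by move=> A B; exact: negligibleU.
move=> x /KC nx; have [U [oU Ux U0]] : exists U, [/\ open U, U x & mu U = 0%E].
  apply: contra_notP nx => nU U oU Ux; rewrite lt0e measure_ge0 andbT.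
  by apply/eqP => U0; apply: nU; exists U.
exists U; first exact: open_nbhs_nbhs.
by apply/negligibleP => //; exact: open_measurable_borel.
Qed.

Lemma measurable_fun_borel (f : G -> R) : continuous f ->
  measurable_fun setT (f : borel G -> R).
Proof.
move=> cf; apply: (measurability _ (RGenOInfty.measurableE R)).
move=> _ [_ [x ->] <-]; rewrite setTI; apply: open_measurable_borel.
by apply: open_comp => //; exact: rray_open.
Qed.

Lemma continuous_ReIm (g : G -> R[i]) : continuous (g : G -> R[i]^o) ->
  continuous (fun x => Re (g x)) /\ continuous (fun x => Im (g x)).
Proof.
move=> cg; split=> x; apply/cvgrPdist_lt => e e0.
  have ec0 : 0 < e%:C%C by rewrite ltcR.
  have /cvgrPdist_lt/(_ _ ec0) := cg x; apply: filterS => t /=.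
  rewrite -ltcR; apply: le_lt_trans; rewrite -raddfB; exact: normc_ge_Re.
have ec0 : 0 < e%:C%C by rewrite ltcR.
have /cvgrPdist_lt/(_ _ ec0) := cg x; apply: filterS => t /=.
rewrite -ltcR; apply: le_lt_trans; rewrite -raddfB normc_def lecR -sqrtr_sqr.
by rewrite ler_wsqrtr// lerDr sqr_ge0.
Qed.

(** If the transform is 1, the nonnegative function [1 - Re g] has integral 0, so the open set where
    [Re g < 1] is null and cannot meet the support. Conversely [g] is 1 almost everywhere, the
    complement of the support being null. *)
Lemma fourier_stieltjes_eq1 g : hausdorff_space G -> regular_measure mu ->
  dual_group R G g -> fourier_stieltjes mu g = 1 <-> {in supp mu, forall x, g x = 1}.
Proof.
move=> hausG regmu [_ g1 cg]; have [cRe cIm] := continuous_ReIm cg.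
have mRe := measurable_fun_borel cRe; have mIm := measurable_fun_borel cIm.
have muT : (mu setT < +oo)%E by rewrite probability_setT ltry.
have n1 x : normsq (g x) = 1 by exact/normsq_eq1.
have Re1 x : `|Re (g x)| <= 1.
  by have := n1 x; rewrite /normsq ler_norml => ?; apply/andP; split; nra.
have FE : fourier_stieltjes mu g =
    Complex (\int[mu]_x Re (g x)) (\int[mu]_x - Im (g x)).
  by rewrite /fourier_stieltjes /complex_integral; congr Complex; apply: eq_Rintegral => x _;
    case: (g x).
have iRe : mu.-integrable setT (EFin \o (fun x => Re (g x))).
  apply: measurable_bounded_integrable => //.
  exists 1; split=> // M M1 x _; exact: le_trans (Re1 x) (ltW M1).
have muT1 : fine (mu setT) = 1 by exact: (congr1 fine (probability_setT mu)).
rewrite FE; split=> [[FRe _] x|g1s].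
  rewrite inE => sx; apply: contrapT => gx.
  pose h x := 1 - Re (g x).
  have h0 y : 0 <= h y by rewrite subr_ge0 (le_trans (ler_norm _)).
  have i1 : mu.-integrable setT (EFin \o (fun=> 1 : R)).
    exact: finite_measure_integrable_cst.
  have ih : mu.-integrable setT (EFin \o h) := integrableB measurableT i1 iRe.
  have int0 : (\int[mu]_x `|(h x)%:E| = 0)%E.
    under eq_integral do rewrite gee0_abs ?lee_fin ?h0//.
    rewrite -[LHS]fineK; last exact: integrable_fin_num.
    congr EFin; transitivity (\int[mu]_x (1 - Re (g x))); first by [].
    rewrite (RintegralB (f1 := fun=> 1))//.
    by rewrite FRe Rintegral_cst// mul1r muT1 subrr.
  have mh := measurable_int mu ih.
  have /(ae_eq_integral_abs mu measurableT mh)[N [mN N0 hN]] := int0.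
  have oU : open [set y | Re (g y) < 1].
    apply: (@open_comp _ _ (fun y => Re (g y)) [set r | r < 1]); last exact: open_lt.
    by move=> y _; exact: cRe.
  have Ux : Re (g x) < 1.
    rewrite lt_neqAle (le_trans (ler_norm _) (Re1 x)) andbT; apply/eqP => Re_x.
    have := n1 x; rewrite /normsq Re_x expr1n => /eqP.
    rewrite -subr_eq0 addrC addKr sqrf_eq0 => /eqP Im_x; apply: gx.
    by move: Re_x Im_x; case: (g x) => a b /= -> ->.
  have := sx _ oU Ux; rewrite ltNge => /negP; apply.
  rewrite -N0; apply: le_measure; rewrite ?inE//; first exact: open_measurable_borel.
  move=> y /= Uy; apply: hN => /= /(_ I) [/eqP]; rewrite subr_eq0 => /eqP Re_y.
  by move: Uy; rewrite -Re_y ltxx.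
have ae1 (P : G -> Prop) : (forall x, supp mu x -> P x) -> {ae mu, forall x : borel G, P x}.
  move=> sP; exists (~` supp mu); split.
  - exact: open_measurable_borel open_setC_supp.
  - exact: measure_setC_supp.
  - by move=> x /=; apply: contra_not; exact: sP.
have g1s' x : supp mu x -> g x = 1 by move=> sx; apply: g1s; rewrite inE.
congr Complex.
  rewrite /Rintegral (ae_eq_integral (cst 1%:E))//.
  - by rewrite integral_cst// mul1e muT1.
  - exact/measurable_EFinP.
  - by apply: ae1 => x /g1s' gx _; rewrite /= gx.
rewrite /Rintegral (ae_eq_integral (cst 0%:E))//.
- by rewrite integral0.
- by apply/measurable_EFinP; exact: measurableT_comp.
- by apply: ae1 => x /g1s' gx _; rewrite /= gx /= oppr0.
Qed.

End support.

(** * The equivalence of the three conditions *)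

Lemma closed_subgroup_generatedP (G : topologicalZmodType) (S : set G) :
  closed_subgroup (closed_subgroup_generated S).
Proof.
split; last first.
  by apply: closed_bigI => H [[_ cH] _].
split; first by rewrite inE => H [[[H0 _] _] _]; rewrite -in_setE.
move=> x y; rewrite !inE => xH yH H HP; have [[[_ HB] _] _] := HP.
by rewrite -in_setE; apply: HB; rewrite inE; [exact: xH|exact: yH].
Qed.

Theorem proposition2p1 (R : realType) (G : topologicalZmodType)
    (hausG : hausdorff_space G) (lcG : locally_compact [set: G])
    (mu : probability (borel G) R) (regmu : regular_measure mu) :
  [<-> adapted mu;
       forall g, g \in dual_group R G ->
         {in supp mu, forall x, g x = 1} -> g = trivial_character;
       [set g | g \in dual_group R G /\ fourier_stieltjes mu g = 1]
         = [set trivial_character] ].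
Proof.
have triv_dual : dual_group R G trivial_character.
  split=> [x y|x|x]; rewrite /trivial_character /= ?mulr1 ?normr1//.
  exact: cvg_cst.
tfae.
- move=> adm g /set_mem [gD g1 cg] gs; apply/funext => x.
  (* The kernel of [g] is a closed subgroup that contains the support, hence everything. *)
  have sub : closed_subgroup [set x | g x = 1].
    split; last first.
      apply: (@closed_comp G R[i]^o g [set 1]) => [y _|]; first exact: cg.
      exact/accessible_closed_set1/hausdorff_accessible/(@norm_hausdorff _ R[i]^o).
    have g0 : g 0 = 1.
      have gn0 : g 0 != 0 by rewrite -normr_eq0 g1 oner_eq0.
      by apply: (mulfI gn0); rewrite -gD addr0 mulr1.
    split; first by rewrite inE.
    move=> a b; rewrite !inE /= => ga gb.
    by rewrite -[LHS]mulr1 -{1}gb -gD subrK.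
  have gen : closed_subgroup_generated (supp mu) `<=` [set x | g x = 1].
    by apply: smallest_sub => // y sy; apply: gs; rewrite inE.
  by apply: gen; rewrite adm.
- move=> sep; apply/seteqP; split=> [g [gd]|_ ->].
    by move/(fourier_stieltjes_eq1 hausG regmu (set_mem gd)); exact: sep.
  split; first by rewrite inE.
  exact: (fourier_stieltjes_eq1 hausG regmu triv_dual).2.
(* A point [a] outside the generated closed subgroup would yield a nontrivial character equal to 1
   on the support, whose transform would be 1. *)
- move=> fs; rewrite /adapted; apply/seteqP; split=> // a _; apply: contrapT => na.
  have [chi [chiD chiH chia]] :=
    dual_group_exists R lcG (@closed_subgroup_generatedP G (supp mu)) na.
  have : [set g | g \in dual_group R G /\ fourier_stieltjes mu g = 1] chi.
    split; first by rewrite inE.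
    apply: (fourier_stieltjes_eq1 hausG regmu chiD).2 => x; rewrite inE => sx.
    by apply: chiH; exact: sub_gen_smallest.
  by rewrite fs => /= chi1; move: chia; rewrite chi1 eqxx.
Qed.
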